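(* Let $0<r\le1$, let $X$ be an r.i. space on $(0,1)$ and let $\psi\in\mathcal{A}_0$. Then the following statements are equivalent: (i) There exists a constant $C>0$ such that $$\|f\|_{L^\infty}\le C\left(\left\|\frac{O(|f|^r,\cdot)^{1/r}}{\psi(\cdot)}\right\|_X+\|f\|_{L^r}\right)$$ for every measurable $f\in L^0(0,1)$. (ii) $$\left\|\frac{\psi(s)^r}{s}\chi_{(0,1)}(s)\right\|_{(X^{(1/r)})'}<\infty.$$
   Context: All function spaces are over $(0,1)$ with Lebesgue measure; $L^0=L^0(0,1)$ is the space of a.e. finite measurable functions. The decreasing rearrangement of $f$ is $f^*(s)=\inf\{t>0:|\{x\in(0,1):|f(x)|>t\}|\le s\}$, and $f^{**}(t)=\frac1t\int_0^t f^*(s)\,ds$ for $0<t<1$. For $0<r\le1$, $O(|f|^r,t):=(|f|^r)^{**}(t)-(|f|^r)^*(t)$. Also $\|f\|_{L^r}=(\int_0^1|f|^r)^{1/r}$. An r.i. space $X$ is a Banach function space on $(0,1)$ (in the sense of Bennett--Sharpley) such that $\|f\|_X=\|g\|_X$ whenever $f^*=g^*$; norms are $+\infty$ for functions not in the space. The associate space $X'$ has norm $\|g\|_{X'}=\sup_{\|f\|_X\le1}\int_0^1|f(s)g(s)|\,ds$. For $p>0$ the $p$-convexification is $X^{(p)}=\{f:|f|^p\in X\}$, $\|f\|_{X^{(p)}}=\||f|^p\|_X^{1/p}$. Class $\mathcal{A}_0$: for a positive function $\psi$ on $(0,1)$ put $m_\psi(t)=\sup\{\psi(st)/\psi(s):0<s<1,\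 st<1\}$, $t>0$. If $m_\psi(t)<\infty$ for all $t>0$, the fundamental indices of $\psi$ are $\underline{\beta}_\psi=\lim_{t\to0^+}\frac{\log m_\psi(t)}{\log t}$ and $\overline{\beta}_\psi=\lim_{t\to\infty}\frac{\log m_\psi(t)}{\log t}$. $\mathcal{A}_0$ is the class of increasing positive functions $\psi:(0,1)\to(0,\infty)$ with $m_\psi<\infty$, $\psi(0^+)=0$ and $0<\underline{\beta}_\psi\le\overline{\beta}_\psi<1$. *)

(* Defs.v *)
(* MathComp-Analysis *)
From HB Require Import structures.
From mathcomp Require Import all_boot all_order all_algebra.
From mathcomp Require Import all_classical all_reals all_analysis measurable_realfun.
Set Implicit Arguments.
Unset Strict Implicit.
Unset Printing Implicit Defensive.
Import Order.TTheory GRing.Theory Num.Theory.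
Import numFieldNormedType.Exports.
Local Open Scope classical_set_scope.
Local Open Scope ring_scope.
Local Open Scope ereal_scope.

(* Functions on (0,1) are total functions R -> \bar R of which only the values
   on (0,1) matter.  Measurability is Borel measurability; every Lebesgue
   measurable function is a.e. equal to a Borel one. *)

Definition I01 {R : realType} : set R := `]0%R, 1%R[%classic.

(* M(0,1) *)
Definition meas01 (R : realType) (f : R -> \bar R) : Prop :=
  measurable_fun I01 f.

(* M^+(0,1) *)
Definition Mplus (R : realType) (f : R -> \bar R) : Prop :=
  meas01 f /\ forall x, I01 x -> 0 <= f x.

Definition L0 (R : realType) (f : R -> \bar R) : Prop :=
  meas01 f /\ \forall x \ae lebesgue_measure, I01 x -> f x \is a fin_num.

Definition abspow (R : realType) (p : R) (f : R -> \bar R) : R -> \bar R :=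
  fun x => `|f x| `^ p.

Definition Lp01 (R : realType) (p : \bar R) (f : R -> \bar R) : \bar R :=
  'N[lebesgue_measure]_p[f \_ I01].

(* f^* *)
Definition rearr (R : realType) (f : R -> \bar R) (s : R) : \bar R :=
  ereal_inf [set t%:E | t in [set t : R |
    (0 < t)%R /\ lebesgue_measure [set x | I01 x /\ t%:E < `|f x|] <= s%:E]].

(* f^** *)
Definition maxrearr (R : realType) (f : R -> \bar R) (t : R) : \bar R :=
  (t^-1)%:E * \int[lebesgue_measure]_(s in `]0%R, t[%classic) rearr f s.

(* For f in L0 and 0 < t < 1 the subtrahend is finite, so the convention
   for +oo - +oo plays no role; the oscillation is +oo when |f|^r is not
   integrable. *)
Definition osc (R : realType) (r : R) (f : R -> \bar R) (t : R) : \bar R :=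
  maxrearr (abspow r f) t - rearr (abspow r f) t.

(* Bennett-Sharpley's axioms for a Banach function norm
   rho : M^+(0,1) -> [0,+oo]. *)
Record banach_function_norm (R : realType) (rho : (R -> \bar R) -> \bar R) :
    Prop := {
  bfn_ge0 : forall f, Mplus f -> 0 <= rho f ;
  bfn_eq0 : forall f, Mplus f ->
    (rho f = 0 <-> \forall x \ae lebesgue_measure, I01 x -> f x = 0) ;
  bfn_scale : forall (a : R) f, (0 <= a)%R -> Mplus f ->
    rho (fun x => a%:E * f x) = a%:E * rho f ;
  bfn_triangle : forall f g, Mplus f -> Mplus g ->
    rho (fun x => f x + g x) <= rho f + rho g ;
  bfn_mono : forall f g, Mplus f -> Mplus g ->
    (\forall x \ae lebesgue_measure, I01 x -> g x <= f x) -> rho g <= rho f ;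
  bfn_fatou : forall (fn : nat -> R -> \bar R) f,
    (forall n, Mplus (fn n)) -> Mplus f ->
    (\forall x \ae lebesgue_measure, I01 x ->
       {homo (fn ^~ x) : m n / (m <= n)%N >-> m <= n} /\
       fn n x @[n --> \oo] --> f x) ->
    rho (fn n) @[n --> \oo] --> rho f ;
  bfn_indic : forall E : set R, measurable E -> E `<=` I01 ->
    rho (fun x => (\1_E x)%:E) < +oo ;
  bfn_int : forall E : set R, measurable E -> E `<=` I01 ->
    exists2 C : R, (0 < C)%R &
      forall f, Mplus f -> \int[lebesgue_measure]_(x in E) f x <= C%:E * rho f
}.

(* The norm of X(rho), +oo outside the space. *)
Definition Xnorm (R : realType) (rho : (R -> \bar R) -> \bar R)
    (f : R -> \bar R) : \bar R := rho (fun x => `|f x|).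

Record ri_norm (R : realType) (rho : (R -> \bar R) -> \bar R) : Prop := {
  ri_bfn : banach_function_norm rho ;
  ri_rearr : forall f g, L0 f -> L0 g ->
    (forall s, I01 s -> rearr f s = rearr g s) -> Xnorm rho f = Xnorm rho g
}.

(* The norm of X^(p), from the norm N of X. *)
Definition convexification (R : realType) (N : (R -> \bar R) -> \bar R) (p : R)
    (f : R -> \bar R) : \bar R := N (abspow p f) `^ p^-1.

(* The norm of X', from the norm N of X. *)
Definition associate (R : realType) (N : (R -> \bar R) -> \bar R)
    (g : R -> \bar R) : \bar R :=
  ereal_sup [set \int[lebesgue_measure]_(s in I01) `|f s * g s| |
    f in [set f | meas01 f /\ N f <= 1]].

(* m_psi *)
Definition dilfun (R : realType) (psi : R -> R) (t : R) : \bar R :=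
  ereal_sup [set (psi (s * t) / psi s)%:E |
    s in [set s : R | (0 < s < 1)%R /\ (s * t < 1)%R]].

(* The fundamental indices as limits; m_psi is finite in the class A_0, so that
   [fine] loses nothing. *)
Definition lower_index (R : realType) (psi : R -> R) (b : R) : Prop :=
  (ln (fine (dilfun psi t)) / ln t)%R @[t --> 0%R^'+] --> b.

Definition upper_index (R : realType) (psi : R -> R) (b : R) : Prop :=
  (ln (fine (dilfun psi t)) / ln t)%R @[t --> +oo%R] --> b.

(* "Increasing" is read as nondecreasing. *)
Record classA0 (R : realType) (psi : R -> R) : Prop := {
  A0_incr : forall s t : R, (0 < s)%R -> (s <= t)%R -> (t < 1)%R ->
    (psi s <= psi t)%R ;
  A0_pos : forall s, I01 s -> (0 < psi s)%R ;
  A0_dil : forall t : R, (0 < t)%R -> dilfun psi t < +oo ;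
  A0_lim0 : psi s @[s --> 0%R^'+] --> 0%R ;
  A0_indices : exists bl bu : R, [/\ lower_index psi bl, upper_index psi bu,
    (0 < bl)%R, (bl <= bu)%R & (bu < 1)%R]
}.

(* Main.v *)
Require Import Defs.
From HB Require Import structures.
From mathcomp Require Import all_boot all_order all_algebra.
From mathcomp Require Import all_classical all_reals all_analysis measurable_realfun ess_sup_inf.
From mathcomp Require Import ring lra.
Set Implicit Arguments.
Unset Strict Implicit.
Unset Printing Implicit Defensive.
Import Order.TTheory GRing.Theory Num.Theory.
Import numFieldNormedType.Exports.
Local Open Scope classical_set_scope.
Local Open Scope ring_scope.
Local Open Scope ereal_scope.

(** Write [w s = psi s `^ r / s] for the weight of (ii).  Let [g = |f| `^ r] and let
    [O] be its oscillation.

    (ii) implies (i) because [maxrearr g] has derivative [- O t / t]: integrating,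
    the essential supremum of [g] is the integral of [g] plus that of [O t / t]
    over (0,1).  No derivative is needed for the inequality that matters, which is
    an exchange of integrals ([rearr_le_osc]).  As [O t / t] is the product of
    [O / psi `^ r] and [w], and the norm of [O / psi `^ r] in the convexified space is
    the r-th power of the norm of [O `^ r^-1 / psi] in X, the conclusion is the
    duality between this space and its associate ([ess_sup_le_of_associate]).

    (i) implies (ii) by testing.  Let [u] be in the unit ball of the convexified
    space.  The upper index of [psi] is less than one and [r <= 1], so [w] is
    decreasing up to a constant, and the Hardy--Littlewood inequality
    ([hardy_littlewood]) reduces the integral of [u * w] to the one in which [u] is
    replaced with its decreasing rearrangement, that is, to [u = F `^ r] with [F]
    nonincreasing in the unit ball of X.  Let [h x] be the integral of [F `^ r * w]
    over (x,1).  It is nonincreasing, its supremum is the integral to be bounded,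
    and its oscillation at [t] is the mean of [(F * psi) `^ r] over (0,t)
    ([osc_tail]).  Jensen's inequality bounds this by the r-th power of the mean of
    [F * psi].  Applying (i) to [h `^ r^-1], everything comes down to a bound in X
    for the operator that sends [F] to the mean of [F * psi] over (0,t) divided by
    [psi t], on nonincreasing functions ([hardy_majorant]).

    For this operator interpolation theory is avoided.  The dilation that sends [F]
    to [F (t / N)] has norm at most [N] on nonincreasing functions, since for
    [N = 2] the dilated function is equimeasurable with two copies of the first half
    of [F] put side by side ([dilation2_le]); and the lower index being positive, [psi (t / N)]
    is at most [psi t / 2] for some power [N] of two.  Cutting the mean at [t / N]
    then gives a recursion that contracts. *)

(** * The decreasing rearrangement *)

Lemma measurable_I01 (R : realType) : measurable (@I01 R).
Proof. exact: measurable_itv. Qed.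

Lemma in_I01 (R : realType) (x : R) : I01 x <-> (0 < x < 1)%R.
Proof. by rewrite /I01 /= in_itv. Qed.

Lemma is_interval_I01 (R : realType) : is_interval (@I01 R).
Proof. exact: interval_is_interval. Qed.

Lemma nonincr_measurable (R : realType) (D : set R) (f : R -> \bar R) :
  is_interval D ->
  (forall s t, D s -> D t -> (s <= t)%R -> f t <= f s) ->
  measurable_fun D f.
Proof.
move=> iD fi _.
apply: (measurability _ (ErealGenOInfty.measurableE R)); last first.
  exact: is_interval_measurable.
move=> _ [_ [r ->] <-].
apply: is_interval_measurable => x y [Dx /= fx] [Dy /= fy] z /andP[xz zy].
have Dz : D z by apply: (iD x y) => //; rewrite xz.
split=> //=; move: fy; rewrite !in_itv /= !andbT => /lt_le_trans; apply.
exact: fi.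
Qed.

Lemma nondecr_measurable (R : realType) (D : set R) (f : R -> \bar R) :
  is_interval D ->
  (forall s t, D s -> D t -> (s <= t)%R -> f s <= f t) ->
  measurable_fun D f.
Proof.
move=> iD fi.
have -> : f = (fun x => - (- f x)) by apply/funext => x; rewrite oppeK.
apply: measurableT_comp => //; apply: nonincr_measurable => // s t Ds Dt st.
by rewrite leeN2; exact: fi.
Qed.

Definition distr (R : realType) (f : R -> \bar R) (t : R) : \bar R :=
  lebesgue_measure [set x | I01 x /\ t%:E < `|f x|].

Lemma measurable_superlevel (R : realType) (f : R -> \bar R) (t : R) :
  meas01 f -> measurable [set x | I01 x /\ t%:E < `|f x|].
Proof.
move=> mf.
have mf' : measurable_fun I01 (fun x => `|f x|) by exact: measurableT_comp.
exact: (emeasurable_fun_o_infty (@measurable_I01 R) mf').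
Qed.

Lemma le_distr (R : realType) (f g : R -> \bar R) (s t : R) :
  meas01 f -> meas01 g -> (forall x, I01 x -> `|f x| <= `|g x|) ->
  (s <= t)%R -> distr f t <= distr g s.
Proof.
move=> mf mg fg st; apply: le_measure; rewrite ?inE; [exact: measurable_superlevel..|].
move=> x [Ix tf]; split => //; apply: le_lt_trans (lt_le_trans tf (fg x Ix)).
by rewrite lee_fin.
Qed.

Lemma distr_le1 (R : realType) (f : R -> \bar R) (t : R) : meas01 f -> distr f t <= 1.
Proof.
move=> mf; have <- : lebesgue_measure (@I01 R) = 1.
  by rewrite /I01 lebesgue_measure_itv /= lte_fin ltr01 EFinN oppe0 adde0.
apply: le_measure; rewrite ?inE; [exact: measurable_superlevel | exact: measurable_I01|].
by move=> x [].
Qed.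

Lemma distr_ge0 (R : realType) (f : R -> \bar R) (t : R) : 0 <= distr f t.
Proof. exact: measure_ge0. Qed.

Lemma rearrE (R : realType) (f : R -> \bar R) (s : R) : rearr f s =
  ereal_inf [set t%:E | t in [set t : R | (0 < t)%R /\ distr f t <= s%:E]].
Proof. by []. Qed.

Lemma rearr_ge0 (R : realType) (f : R -> \bar R) (s : R) : 0 <= rearr f s.
Proof.
by rewrite rearrE; apply: le_ereal_inf_tmp => _ [t [t0 _] <-]; rewrite lee_fin ltW.
Qed.

(** Right continuity: the superlevel sets of [f] increase to the one at level [t] as
    the level decreases to [t]. *)
Lemma distr_right_cont (R : realType) (f : R -> \bar R) (t s : R) :
  meas01 f -> (forall t' : R, (t < t')%R -> distr f t' <= s%:E) ->
  distr f t <= s%:E.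
Proof.
move=> mf h.
pose F n := [set x | I01 x /\ (t + n.+1%:R^-1)%:E < `|f x|].
have FU : [set x | I01 x /\ t%:E < `|f x|] = \bigcup_n F n.
  apply/seteqP; split => x.
    move=> [Ix tf].
    case E : `|f x| tf => [a| |]; last by [].
      rewrite lte_fin => ta.
      have [n _ Hn] : exists2 n, True & (n.+1%:R^-1 < a - t)%R.
        have at0 : (0 < a - t)%R by rewrite subr_gt0.
        have := @near_infty_natSinv_lt R (PosNum at0).
        by move=> [n _ /(_ n (leqnn n)) /= hn]; exists n.
      by exists n => //; split => //; rewrite E lte_fin -ltrBrDl.
    by move=> _; exists 0%N => //; split => //; rewrite E ltry.
  move=> [n _ [Ix tf]]; split => //; apply: le_lt_trans tf.
  by rewrite lee_fin lerDl invr_ge0.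
have cv : lebesgue_measure (F n) @[n --> \oo] --> lebesgue_measure (\bigcup_n F n).
  apply: nondecreasing_cvg_mu.
  - by move=> n; exact: measurable_superlevel.
  - by rewrite -FU; exact: measurable_superlevel.
  - move=> m n mn; rewrite subsetEset => x [Ix tf]; split => //.
    apply: le_lt_trans tf; rewrite lee_fin lerD2l lef_pV2 ?posrE //.
    by rewrite ler_nat.
rewrite /distr FU -(cvg_lim _ cv)//; apply: lime_le; first by apply: cvgP cv.
by apply: nearW => n; apply: h; rewrite ltrDl invr_gt0.
Qed.

(** A Galois connection, by right continuity of the distribution function.  It is
    the only access to the infimum that defines the rearrangement. *)
Lemma lt_rearr (R : realType) (f : R -> \bar R) (t s : R) :
  meas01 f -> (0 <= t)%R -> (t%:E < rearr f s) = (s%:E < distr f t).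
Proof.
move=> mf t0; apply/idP/idP => [|h].
  apply: contraTT; rewrite -!leNgt => h; apply/lee_addgt0Pr => e e0.
  rewrite rearrE -EFinD; apply: ereal_inf_lbound; exists (t + e)%R => //; split.
    by rewrite ltr_wpDl.
  by apply: le_trans h; apply: le_distr => //; rewrite lerDl ltW.
rewrite ltNge; apply/negP => h'.
suff : distr f t <= s%:E by rewrite leNgt h.
apply: distr_right_cont => // t' tt'.
have : rearr f s < t'%:E by rewrite (le_lt_trans h')// lte_fin.
rewrite rearrE => /ereal_inf_lt[_ [t2 [t20 d2] <-]]; rewrite lte_fin => t2t'.
by apply: le_trans d2; apply: le_distr => //; exact: ltW.
Qed.

(** Lets equalities of rearrangements be proved through [lt_rearr]. *)
Lemma ge0_eq_by_lt (R : realType) (x y : \bar R) : 0 <= x -> 0 <= y ->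
  (forall t : R, (0 <= t)%R -> (t%:E < x) = (t%:E < y)) -> x = y.
Proof.
move=> + + h; wlog: x y h / x < y => [H x0 y0|].
  have [xy|yx|//] := ltgtP x y; first by apply: H.
  by apply/esym/H => // t t0; rewrite h.
move=> xy x0 y0; have xf : x \is a fin_num.
  by rewrite ge0_fin_numE// (lt_le_trans xy)// leey.
have := h (fine x) (fine_ge0 x0); rewrite fineK// xy.
by rewrite ltxx.
Qed.

Lemma rearr_mono (R : realType) (f : R -> \bar R) (s t : R) :
  (s <= t)%R -> rearr f t <= rearr f s.
Proof.
move=> st; rewrite !rearrE; apply: ereal_inf_le_tmp => _ [a [a0 da] <-].
by exists a => //; split => //; apply: le_trans da _; rewrite lee_fin.
Qed.

Lemma measurable_rearr (R : realType) (f : R -> \bar R) : meas01 (rearr f).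
Proof.
by apply: nonincr_measurable => [|s t _ _]; [exact: is_interval_I01|exact: rearr_mono].
Qed.

Lemma rearr_Mplus (R : realType) (f : R -> \bar R) : Mplus (rearr f).
Proof. by split => [|x _]; [exact: measurable_rearr|exact: rearr_ge0]. Qed.

(** The rearrangement and the function have superlevel sets of the same measure, but
    those of the rearrangement are intervals that start at the origin. *)
Lemma superlevel_rearr (R : realType) (f : R -> \bar R) (t : R) : meas01 f ->
  (0 <= t)%R ->
  [set x | I01 x /\ t%:E < `|rearr f x|] = `]0%R, fine (distr f t)[%classic.
Proof.
move=> mf t0.
have fd : distr f t \is a fin_num.
  by rewrite ge0_fin_numE ?distr_ge0// (le_lt_trans (distr_le1 _ mf))// ltry.
apply/seteqP; split => x /=.
  rewrite gee0_abs ?rearr_ge0// lt_rearr// -{1}(fineK fd) lte_fin in_itv /=.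
  by move=> [/in_I01/andP[-> _]].
rewrite in_itv /= => /andP[x0 xd].
rewrite gee0_abs ?rearr_ge0// lt_rearr// -(fineK fd) lte_fin; split => //.
apply/in_I01; rewrite x0 (lt_le_trans xd)//.
by rewrite -lee_fin fineK// distr_le1.
Qed.

Lemma distr_rearr (R : realType) (f : R -> \bar R) (t : R) : meas01 f ->
  (0 <= t)%R -> distr (rearr f) t = distr f t.
Proof.
move=> mf t0.
have fd : distr f t \is a fin_num.
  by rewrite ge0_fin_numE ?distr_ge0// (le_lt_trans (distr_le1 _ mf))// ltry.
rewrite {1}/distr superlevel_rearr// lebesgue_measure_itv /= lte_fin.
case: ltP => [h|]; first by rewrite EFinN oppe0 adde0 fineK.
move=> h; apply/esym/eqP; rewrite eq_le distr_ge0 andbT -(fineK fd).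
by rewrite lee_fin.
Qed.

Lemma eq_rearr (R : realType) (f g : R -> \bar R) :
  (forall t : R, (0 < t)%R -> distr f t = distr g t) -> rearr f = rearr g.
Proof.
move=> h; apply/funext => s; rewrite !rearrE; congr (ereal_inf (_ @` _)).
by apply/seteqP; split => t [t0]; rewrite ?h// => dt; split=> //; rewrite h.
Qed.

Lemma rearr_idem (R : realType) (f : R -> \bar R) : meas01 f ->
  rearr (rearr f) = rearr f.
Proof. by move=> mf; apply: eq_rearr => t t0; rewrite distr_rearr// ltW. Qed.

Lemma abspow_measurable (R : realType) (p : R) (f : R -> \bar R) : meas01 f ->
  meas01 (abspow p f).
Proof.
move=> mf; rewrite /abspow; apply: (measurableT_comp (measurable_poweR p)).
exact: measurableT_comp.
Qed.

Lemma abspow_ge0 (R : realType) (p : R) (f : R -> \bar R) x : 0 <= abspow p f x.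
Proof. exact: poweR_ge0. Qed.

Lemma le_poweR (R : realType) (p : R) (x y : \bar R) : (0 <= p)%R -> 0 <= x ->
  x <= y -> x `^ p <= y `^ p.
Proof.
move=> p0 x0 xy; apply: gt0_ler_poweR => //; rewrite in_itv /= leey andbT//.
exact: le_trans xy.
Qed.

Lemma lt_poweR_root (R : realType) (p t : R) (x : \bar R) : (0 < p)%R ->
  (0 <= t)%R -> 0 <= x -> (t%:E < x `^ p) = ((t `^ p^-1)%:E < x).
Proof.
move=> p0 t0; case: x => [a| |]; last by [].
  rewrite lee_fin poweR_EFin !lte_fin => a0; apply/idP/idP => h.
    have := gt0_ltr_powR (r := p^-1) _ _ _ h.
    rewrite -powRrM mulfV ?gt_eqF// powRr1//; apply; rewrite ?invr_gt0 ?nnegrE//.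
    exact: powR_ge0.
  have := gt0_ltr_powR p0 _ _ h.
  rewrite -powRrM mulVf ?gt_eqF// powRr1//; apply; rewrite ?nnegrE//.
  exact: powR_ge0.
by move=> _; rewrite poweRyr ?gt_eqF// !ltry.
Qed.

Lemma distr_abspow (R : realType) (p t : R) (f : R -> \bar R) : (0 < p)%R ->
  (0 <= t)%R -> distr (abspow p f) t = distr f (t `^ p^-1).
Proof.
move=> p0 t0; congr (lebesgue_measure _); apply/seteqP; split => x /= [Ix];
  by rewrite (gee0_abs (abspow_ge0 _ _ _)) /abspow lt_poweR_root.
Qed.

Lemma rearr_abspow (R : realType) (p : R) (f : R -> \bar R) : (0 < p)%R ->
  meas01 f -> rearr (abspow p f) = abspow p (rearr f).
Proof.
move=> p0 mf; apply/funext => s; apply: ge0_eq_by_lt; rewrite ?rearr_ge0 ?abspow_ge0//.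
move=> t t0; rewrite lt_rearr//; last exact: abspow_measurable.
rewrite distr_abspow// /abspow gee0_abs ?rearr_ge0// lt_poweR_root ?rearr_ge0//.
by rewrite lt_rearr// powR_ge0.
Qed.

(** * The Hardy--Littlewood inequality for almost decreasing weights *)

(** Tonelli's theorem for the product of two functions cut off to a planar set, in the
    form used for the layer-cake formula, for tail integrals and for the oscillation *)
Lemma tonelli_region (R : realType) (D E : set R)
    (A : set (measurableTypeR R * measurableTypeR R)) (a b : R -> \bar R) :
  measurable D -> measurable E -> measurable A ->
  measurable_fun D a -> measurable_fun E b ->
  (forall x, D x -> 0 <= a x) -> (forall x, E x -> 0 <= b x) ->
  \int[lebesgue_measure]_(x in D)
    (a x * \int[lebesgue_measure]_(y in E `&` xsection A x) b y) =
  \int[lebesgue_measure]_(y in E)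
    (b y * \int[lebesgue_measure]_(x in D `&` ysection A y) a x).
Proof.
move=> mD mE mA ma mb a0 b0.
pose a' : measurableTypeR R -> \bar R := a \_ D.
pose b' : measurableTypeR R -> \bar R := b \_ E.
have ma' : measurable_fun setT a' by exact/(measurable_restrictT _ _).1.
have mb' : measurable_fun setT b' by exact/(measurable_restrictT _ _).1.
have a'0 x : 0 <= a' x by exact: erestrict_ge0.
have b'0 x : 0 <= b' x by exact: erestrict_ge0.
pose f (z : measurableTypeR R * measurableTypeR R) :=
  a' z.1 * b' z.2 * (\1_A z)%:E.
have mf : measurable_fun setT f.
  apply: emeasurable_funM; last by apply/measurable_EFinP; exact: measurable_indic.
  by apply: emeasurable_funM; apply: measurableT_comp.
have f0 z : 0 <= f z by rewrite /f !mule_ge0// lee_fin.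
have := fubini_tonelli (m1 := lebesgue_measure) (m2 := lebesgue_measure) f mf f0.
rewrite [X in X = _ -> _](_ : _ = \int[lebesgue_measure]_(x in D)
    (a x * \int[lebesgue_measure]_(y in E `&` xsection A x) b y)); last first.
  rewrite [RHS]integral_mkcond; apply: eq_integral => x _.
  have mAx : measurable (xsection A x) by exact: measurable_xsection.
  transitivity (a' x * \int[lebesgue_measure]_(y in E `&` xsection A x) b y).
    rewrite /f [in RHS]integral_mkcond -ge0_integralZl//=.
    - apply: eq_integral => y _; rewrite -muleA; congr (_ * _).
      rewrite !patchE /b' patchE in_setI indicE mem_xsection.
      by case: (y \in E); case: ((x, y) \in A); rewrite ?mule1 ?mule0.
    - apply/(measurable_restrictT _ _).1; first exact: measurableI.
      by apply: measurable_funS mb.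
    - by move=> y _; apply: erestrict_ge0 => z [Ez _]; exact: b0.
  by rewrite /a' !patchE; case: ifPn => _; rewrite ?mul0e.
rewrite [X in _ = X -> _](_ : _ = \int[lebesgue_measure]_(y in E)
    (b y * \int[lebesgue_measure]_(x in D `&` ysection A y) a x))//.
rewrite [RHS]integral_mkcond; apply: eq_integral => y _.
have mAy : measurable (ysection A y) by exact: measurable_ysection.
transitivity (b' y * \int[lebesgue_measure]_(x in D `&` ysection A y) a x).
  rewrite /f [in RHS]integral_mkcond -ge0_integralZl//=.
  - apply: eq_integral => x _; rewrite [a' x * _]muleC -muleA; congr (_ * _).
    rewrite !patchE /a' patchE in_setI indicE mem_ysection.
    by case: (x \in D); case: ((x, y) \in A); rewrite ?mule1 ?mule0.
  - apply/(measurable_restrictT _ _).1; first exact: measurableI.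
    by apply: measurable_funS ma.
  - by move=> x _; apply: erestrict_ge0 => z [Dz _]; exact: a0.
by rewrite /b' !patchE; case: ifPn => _; rewrite ?mul0e.
Qed.

Lemma measurable_subgraph (R : realType) (f : measurableTypeR R -> \bar R) :
  measurable_fun setT f ->
  measurable [set z : measurableTypeR R * measurableTypeR R | z.2%:E < f z.1].
Proof.
move=> mf; rewrite -[X in measurable X]setTI; apply: measurable_lte => //.
  by apply/measurable_EFinP.
exact: measurableT_comp.
Qed.

Lemma integral_one (R : realType) (D : set R) : measurable D ->
  \int[lebesgue_measure]_(x in D) (1 : \bar R) = lebesgue_measure D.
Proof. by move=> mD; rewrite integral_cst// mul1e. Qed.

Lemma lebesgue_measure_0lt (R : realType) (c : \bar R) : 0 <= c ->
  lebesgue_measure [set t : R | (0 <= t)%R /\ t%:E < c] = c.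
Proof.
case: c => [c| |//] c0.
- rewrite (_ : [set _ | _] = `[0%R, c[%classic).
    rewrite lebesgue_measure_itv /= lte_fin; case: ltP => h.
      by rewrite EFinN oppe0 adde0.
    by congr EFin; apply/le_anti; rewrite h -lee_fin c0.
  by apply/seteqP; split => t /=; rewrite in_itv /= lte_fin => /andP.
- rewrite (_ : [set _ | _] = `[0%R, +oo[%classic).
    by rewrite lebesgue_measure_itv /= ltry.
  by apply/seteqP; split => t /=; rewrite in_itv /= ltry andbT // => -[].
Qed.

(** Tonelli on the subgraph of [|u|] *)
Lemma layer_cake (R : realType) (u w : R -> \bar R) : meas01 u -> Mplus w ->
  \int[lebesgue_measure]_(x in I01) (w x * `|u x|) =
  \int[lebesgue_measure]_(t in `[0%R, +oo[)
    \int[lebesgue_measure]_(x in [set x | I01 x /\ t%:E < `|u x|]) w x.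
Proof.
move=> mu [mw w0].
have mau : measurable_fun I01 (fun x => `|u x|) by exact: measurableT_comp.
pose U : measurableTypeR R -> \bar R := (fun x => `|u x|) \_ I01.
have mU : measurable_fun setT U.
  by apply/(measurable_restrictT _ _).1 => //; exact: measurable_I01.
have := @tonelli_region _ I01 `[0%R, +oo[%classic _ w (cst 1) (@measurable_I01 R)
  (measurable_itv _) (measurable_subgraph mU) mw (measurable_cst _) w0
  (fun _ _ => lee01).
rewrite [X in X = _ -> _](_ : _ = \int[lebesgue_measure]_(x in I01) (w x * `|u x|)).
  move=> ->; apply: eq_integral => t; rewrite inE /= in_itv /= andbT => t0.
  rewrite mul1e; congr integral; apply/seteqP; split => x /=.
    rewrite /ysection /= => -[Ix]; rewrite inE /= /U patchE mem_set//.
  by move=> [Ix tu]; split => //; rewrite /ysection /= inE /= /U patchE mem_set.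
apply: eq_integral => x; rewrite inE => Ix; congr (_ * _).
have -> : `[0%R, +oo[%classic `&`
    xsection [set z : measurableTypeR R * measurableTypeR R | z.2%:E < U z.1] x
   = [set t : R | (0 <= t)%R /\ t%:E < `|u x|].
  apply/seteqP; split => t /=; rewrite in_itv /= andbT /xsection /= inE /= /U patchE mem_set//.
rewrite integral_one ?lebesgue_measure_0lt//.
have -> : [set t : R | (0 <= t)%R /\ t%:E < `|u x| ] =
    `[0%R, +oo[%classic `&` (EFin @^-1` [set y | y < `|u x| ]).
  by apply/seteqP; split => t /=; rewrite in_itv /= andbT.
apply: measurableI => //; rewrite -[X in measurable X]setTI.
apply: EFin_measurable => //.
by rewrite -[X in measurable X]setTI; exact: emeasurable_fun_infty_o.
Qed.

(** For an almost decreasing weight, an interval at the origin has up to a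
    constant the largest mass among the sets of its measure: outside the interval
    the weight is at most [C * w a], and the part of the interval that is missed,
    which has the same measure, carries at least [w a / C]. *)
Lemma bathtub (R : realType) (w : R -> R) (C a : R) (E : set R) :
  (1 <= C)%R -> measurable_fun I01 w -> (forall x, I01 x -> (0 <= w x)%R) ->
  (forall s t, (0 < s)%R -> (s <= t)%R -> (t < 1)%R -> (w t <= C * w s)%R) ->
  measurable E -> E `<=` I01 -> lebesgue_measure E = a%:E ->
  \int[lebesgue_measure]_(x in E) (w x)%:E <=
  (C ^+ 2)%:E * \int[lebesgue_measure]_(x in `]0%R, a[) (w x)%:E.
Proof.
move=> C1 mw w0 wC mE EI Ea.
have C20 : (0 <= C ^+ 2)%R by rewrite sqr_ge0.
have C2 : (1 <= C ^+ 2)%R by exact: exprn_ege1.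
have a1 : (a <= 1)%R.
  rewrite -lee_fin -Ea.
  have -> : 1%:E = lebesgue_measure (@I01 R).
    by rewrite /I01 lebesgue_measure_itv /= lte_fin ltr01 EFinN oppe0 adde0.
  by apply: le_measure; rewrite ?inE//; exact: measurable_I01.
have a0 : (0 <= a)%R by rewrite -lee_fin -Ea measure_ge0.
have JI : `]0%R, a[%classic `<=` @I01 R.
  move=> x /=; rewrite in_itv /= => /andP[x0 xa]; apply/in_I01.
  by rewrite x0 (lt_le_trans xa).
have mew : measurable_fun I01 (EFin \o w) by exact/measurable_EFinP.
have mewS (S : set R) : S `<=` I01 -> measurable_fun S (fun x => (w x)%:E).
  by move=> SI; apply: (measurable_funS _ SI mew); exact: measurable_I01.
set J := `]0%R, a[%classic in JI *.
have mJ : measurable J by exact: measurable_itv.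
have [a_0|a_n0] := eqVneq a 0%R.
  apply: (@le_trans _ _ (+oo * lebesgue_measure E)).
    rewrite -integral_cst//; apply: ge0_le_integral => //.
    - by move=> x /EI/w0; rewrite lee_fin.
    - exact: mewS.
    - by move=> x _; rewrite leey.
  rewrite Ea a_0 mule0.
  rewrite mule_ge0// ?lee_fin//; apply: integral_ge0 => x Jx.
  by rewrite lee_fin; apply: w0; exact: JI.
have [a_1|a_n1] := eqVneq a 1%R.
  apply: (@le_trans _ _ (\int[lebesgue_measure]_(x in J) (w x)%:E)).
    apply: ge0_subset_integral => //.
    - exact: mewS.
    - by move=> x /JI/w0; rewrite lee_fin.
    - by rewrite /J a_1.
  rewrite -[leLHS]mul1e; apply: lee_wpmul2r; rewrite ?lee_fin//.
  by apply: integral_ge0 => x /JI/w0; rewrite lee_fin.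
have Ia : I01 a.
  by apply/in_I01; rewrite lt_neqAle eq_sym a_n0 a0 /= lt_neqAle a_n1.
have w0e (S : set R) : S `<=` I01 -> forall x, S x -> 0 <= (w x)%:E.
  by move=> SI x /SI/w0; rewrite lee_fin.
have split_int (S T : set R) : measurable S -> measurable T -> S `<=` I01 ->
  \int[lebesgue_measure]_(x in S) (w x)%:E =
  \int[lebesgue_measure]_(x in S `&` T) (w x)%:E +
  \int[lebesgue_measure]_(x in S `\` T) (w x)%:E.
  move=> mS mT SI; rewrite -ge0_integral_setU//.
  - by rewrite setUIDK.
  - exact: measurableI.
  - exact: measurableD.
  - by rewrite setUIDK; exact: mewS.
  - by rewrite setUIDK; exact: w0e.
  - by rewrite disj_set2E; apply/eqP/seteqP; split => x // [[_ +] [_]].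
rewrite (split_int E J)// (split_int J E)//.
have EJf : lebesgue_measure (E `&` J) \is a fin_num.
  rewrite ge0_fin_numE ?measure_ge0//.
  apply: (@le_lt_trans _ _ a%:E); last exact: ltry.
  rewrite -Ea; apply: le_measure; rewrite ?inE//; exact: measurableI.
have eqD : lebesgue_measure (E `\` J) = lebesgue_measure (J `\` E).
  have H1 : lebesgue_measure E = lebesgue_measure (E `\` J) +
    lebesgue_measure (E `&` J) := measureDI lebesgue_measure mE mJ.
  have H2 : lebesgue_measure J = lebesgue_measure (J `\` E) +
    lebesgue_measure (J `&` E) := measureDI lebesgue_measure mJ mE.
  have HJ : lebesgue_measure J = a%:E.
    rewrite /J lebesgue_measure_itv /= lte_fin lt_neqAle eq_sym a_n0 a0 /=.
    by rewrite EFinN oppe0 adde0.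
  rewrite HJ -Ea (setIC J E) H1 in H2.
  have := congr1 (fun z => z - lebesgue_measure (E `&` J)) H2.
  by rewrite !addeK.
have outer : \int[lebesgue_measure]_(x in E `\` J) (w x)%:E <=
    (C * w a)%:E * lebesgue_measure (E `\` J).
  rewrite -integral_cst; last exact: measurableD.
  have DI : E `\` J `<=` I01 by move=> x [/EI].
  apply: ge0_le_integral => //.
  - exact: measurableD.
  - exact: w0e.
  - exact: mewS.
  - move=> x [Ex]; rewrite /J /= in_itv /= => /negP.
    have /in_I01/andP[x0 x1] := EI _ Ex.
    rewrite x0 /= -leNgt => ax; rewrite lee_fin; apply: wC => //.
    by case/in_I01/andP : Ia.
have inner : (w a)%:E * lebesgue_measure (J `\` E) <=
    C%:E * \int[lebesgue_measure]_(x in J `\` E) (w x)%:E.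
  have DI : J `\` E `<=` I01 by move=> x [/JI].
  rewrite -integral_cst; last exact: measurableD.
  rewrite -ge0_integralZl//.
  - apply: ge0_le_integral => //.
    + exact: measurableD.
    + by move=> x _; rewrite lee_fin; exact: w0.
    + by apply: measurable_funeM; exact: mewS.
    + move=> x [+ _]; rewrite /J /= in_itv /= => /andP[x0 xa].
      rewrite -EFinM lee_fin; apply: wC => //; first exact: ltW.
      by case/in_I01/andP : Ia.
  - exact: measurableD.
  - exact: mewS.
  - exact: w0e.
  - by rewrite lee_fin (le_trans _ C1).
have J0 (S : set R) : S `<=` I01 -> 0 <= \int[lebesgue_measure]_(x in S) (w x)%:E.
  by move=> SI; apply: integral_ge0; exact: w0e.
rewrite ge0_muleDr; [|by apply: J0 => x [/JI]..].
apply: leeD.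
  rewrite setIC -[leLHS]mul1e; apply: lee_wpmul2r; rewrite ?lee_fin//.
  by apply: J0 => x [/JI].
apply: (le_trans outer); rewrite eqD EFinM -muleA expr2 EFinM -muleA.
by apply: lee_wpmul2l => //; rewrite lee_fin (le_trans _ C1).
Qed.

(** By the layer-cake formula it suffices to compare the masses of superlevel sets, and
    those of the rearrangement are the intervals of [bathtub]. *)
Lemma hardy_littlewood (R : realType) (w : R -> R) (C : R) (u : R -> \bar R) :
  (1 <= C)%R -> measurable_fun I01 w -> (forall x, I01 x -> (0 <= w x)%R) ->
  (forall s t, (0 < s)%R -> (s <= t)%R -> (t < 1)%R -> (w t <= C * w s)%R) ->
  meas01 u ->
  \int[lebesgue_measure]_(x in I01) ((w x)%:E * `|u x|) <=
  (C ^+ 2)%:E * \int[lebesgue_measure]_(x in I01) ((w x)%:E * rearr u x).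
Proof.
move=> C1 mw w0 wC mu.
have mew : measurable_fun I01 (EFin \o w) by exact/measurable_EFinP.
have Mw : Mplus (EFin \o w) by split => // x /w0; rewrite lee_fin.
rewrite (layer_cake (w := EFin \o w))//.
rewrite [X in _ * X](_ : _ =
    \int[lebesgue_measure]_(x in I01) ((w x)%:E * `|rearr u x|)); last first.
  by apply: eq_integral => x _; rewrite gee0_abs// rearr_ge0.
rewrite (layer_cake (w := EFin \o w))//; last exact: measurable_rearr.
have mnu (f : R -> \bar R) : meas01 f -> measurable_fun (`[0%R, +oo[%classic : set R) (fun t : R =>
    \int[lebesgue_measure]_(x in [set x | I01 x /\ t%:E < `|f x|]) (w x)%:E).
  move=> mf; apply: nonincr_measurable => [|s t _ _ st]; first exact: interval_is_interval.
  apply: ge0_subset_integral.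
  - exact: measurable_superlevel.
  - exact: measurable_superlevel.
  - by apply: (measurable_funS _ _ mew); [exact: measurable_I01|move=> x []].
  - by move=> x [/w0]; rewrite lee_fin.
  - by move=> x /= [Ix tx]; split => //; rewrite (le_lt_trans _ tx)// lee_fin.
have nu0 (f : R -> \bar R) (t : R) :
  0 <= \int[lebesgue_measure]_(x in [set x | I01 x /\ t%:E < `|f x|]) (w x)%:E.
  by apply: integral_ge0 => x [/w0]; rewrite lee_fin.
rewrite -ge0_integralZl//; last 2 first.
  exact: (mnu _ (measurable_rearr u)).
  by rewrite lee_fin sqr_ge0.
apply: ge0_le_integral => //.
- exact: mnu.
- by apply: measurable_funeM; exact: (mnu _ (measurable_rearr u)).
- move=> t; rewrite /= in_itv /= andbT => t0; rewrite superlevel_rearr//.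
  apply: bathtub => //; first exact: measurable_superlevel.
    by move=> x [].
  rewrite fineK// ge0_fin_numE ?distr_ge0//.
  by rewrite (le_lt_trans (distr_le1 _ mu))// ltry.
Qed.

(** * Consequences of the indices of [psi] *)

Lemma dilfun_ge (R : realType) (psi : R -> R) (s t : R) :
  classA0 psi -> (0 < s < 1)%R -> (0 < t)%R -> (s * t < 1)%R ->
  (psi (s * t) <= fine (dilfun psi t) * psi s)%R.
Proof.
move=> psiA /andP[s0 s1] t0 st1.
have ps0 : (0 < psi s)%R by apply: (A0_pos psiA); apply/in_I01; rewrite s0.
have h : (psi (s * t) / psi s)%:E <= dilfun psi t.
  by apply: ereal_sup_ubound; exists s => //; split => //; apply/andP.
have f : dilfun psi t \is a fin_num.
  by rewrite fin_numElt (A0_dil psiA t0) (lt_le_trans (ltNyr _) h).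
by rewrite -ler_pdivrMr// -lee_fin fineK.
Qed.

Lemma dilfun_gt0 (R : realType) (psi : R -> R) (t : R) :
  classA0 psi -> (0 < t)%R -> (0 < fine (dilfun psi t))%R.
Proof.
move=> psiA t0.
(* any point for which both [s] and [s * t] lie in (0,1) *)
pose s : R := ((t + 1)^-1 / 2)%R.
have t1 : (0 < t + 1)%R by rewrite addr_gt0.
have s0 : (0 < s)%R by rewrite divr_gt0// invr_gt0.
have s1 : (s < 1)%R.
  by rewrite ltr_pdivrMr// mul1r invf_plt ?posrE//; apply: (@le_lt_trans _ _ 1%R); lra.
have st1 : (s * t < 1)%R.
  rewrite /s mulrAC ltr_pdivrMr// mul1r mulrC ltr_pdivrMr//; lra.
have := dilfun_ge psiA (s := s) (t := t).
rewrite s0 s1 => /(_ isT t0 st1) h.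
have ps0 : (0 < psi s)%R by apply: (A0_pos psiA); apply/in_I01; rewrite s0.
have pst0 : (0 < psi (s * t))%R.
  by apply: (A0_pos psiA); apply/in_I01; rewrite mulr_gt0.
by rewrite -(pmulr_lgt0 _ ps0) (lt_le_trans pst0).
Qed.

(** The upper index being less than one bounds the dilation function by the
    identity at large arguments; monotonicity of [psi] covers the others. *)
Lemma psi_div_almost_decr (R : realType) (psi : R -> R) : classA0 psi ->
  exists2 C : R, (1 <= C)%R & forall s t, (0 < s)%R -> (s <= t)%R -> (t < 1)%R ->
    (psi t <= C * (t / s) * psi s)%R.
Proof.
move=> psiA; have [bl [bu [_ ubu _ _ bu1]]] := A0_indices psiA.
have : \forall t \near +oo%R, (ln (fine (dilfun psi t)) / ln t < 1 :> R)%R.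
  by apply: (cvgr_lt bu).
move=> [T0 [_ hT0]].
pose T := (Num.max T0 1 + 1)%R.
have T1 : (1 < T)%R by rewrite ltr_pwDr// le_max lexx orbT.
have large t : (T <= t)%R -> (fine (dilfun psi t) <= t)%R.
  move=> Tt; have t1 : (1 < t)%R by exact: lt_le_trans Tt.
  have t0 : (0 < t)%R by rewrite (lt_trans _ t1).
  have /hT0 : (T0 < t)%R by rewrite (lt_le_trans _ Tt)// ltr_pwDr// le_max lexx.
  rewrite ltr_pdivrMr ?ln_gt0// mul1r => h.
  by rewrite -ler_ln ?posrE// ?dilfun_gt0//; exact: ltW.
exists (Num.max 1 (fine (dilfun psi T)))%R; first by rewrite le_max lexx.
move=> s t s0 st t1.
have t0 : (0 < t)%R by exact: lt_le_trans st.
have s1 : (s < 1)%R by exact: le_lt_trans t1.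
have ps0 : (0 < psi s)%R by apply: (A0_pos psiA); apply/in_I01; rewrite s0.
have ts1 : (1 <= t / s)%R by rewrite ler_pdivlMr// mul1r.
have ts0 : (0 < t / s)%R by rewrite divr_gt0.
have sts : (s * (t / s) = t)%R by rewrite mulrCA divff ?gt_eqF// mulr1.
(* For [t / s < T] the point [s] is lowered to [t / T], which does not increase psi. *)
have [Tts|tsT] := leP T (t / s)%R.
  have := dilfun_ge psiA (s := s) (t := (t / s)%R).
  rewrite s0 s1 sts => /(_ isT ts0 t1) /le_trans; apply.
  rewrite ler_pM2r// (le_trans (large _ Tts))// ler_peMl ?(ltW ts0)//.
  by rewrite le_max lexx.
have T0' : (0 < T)%R by rewrite (lt_trans _ T1).
have tT0 : (0 < t / T)%R by rewrite divr_gt0.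
have tTs : (t / T <= s)%R.
  by rewrite ler_pdivrMr// -ler_pdivrMl// mulrC ltW.
have := dilfun_ge psiA (s := (t / T)%R) (t := T).
rewrite tT0 (le_lt_trans tTs s1) divfK ?gt_eqF// => /(_ isT T0' t1) /le_trans; apply.
rewrite -mulrA ler_pM//; [exact: ltW (dilfun_gt0 psiA T0')| |by rewrite le_max lexx orbT|].
  by apply/ltW/(A0_pos psiA)/in_I01; rewrite tT0 (le_lt_trans tTs s1).
rewrite (le_trans (A0_incr psiA tT0 tTs s1))// ler_peMl//.
exact: ltW.
Qed.

Lemma psi_bounded (R : realType) (psi : R -> R) : classA0 psi ->
  exists2 B : R, (0 < B)%R & forall s, I01 s -> (psi s <= B)%R.
Proof.
move=> psiA; have [C C1 hC] := psi_div_almost_decr psiA.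
have I2 : I01 (2^-1 : R)%R by apply/in_I01; lra.
have p2 := A0_pos psiA I2.
have C0 : (0 < C)%R by rewrite (lt_le_trans _ C1).
exists (C * 2 * psi 2^-1)%R; first by rewrite !mulr_gt0.
move=> s /in_I01/andP[s0 s1].
have [s2|s2] := leP s 2^-1%R.
  apply: (le_trans (A0_incr psiA s0 s2 _)); first lra.
  by rewrite ler_peMl ?(ltW p2)//; lra.
apply: (le_trans (hC 2^-1%R s _ (ltW s2) s1)); first lra.
rewrite ler_pM2r// ler_pM2l// invrK; lra.
Qed.

(** As the lower index is positive, the dilation function tends to zero at zero. *)
Lemma psi_halving (R : realType) (psi : R -> R) : classA0 psi ->
  exists j : nat, forall t, I01 t ->
    (psi (t / (2 ^ j)%:R) <= 2^-1 * psi t)%R.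
Proof.
move=> psiA; have [bl [bu [lbl _ bl0 _ _]]] := A0_indices psiA.
have : \forall t \near 0%R^'+, (bl / 2 < ln (fine (dilfun psi t)) / ln t :> R)%R.
  by apply: (cvgr_gt bl); rewrite // ltr_pdivrMr//; lra.
move=> [e1 /= e10 he1].
(* With [ln (dilfun psi t) < (bl / 2) * ln t] this makes [dilfun psi t] less than 1 / 2. *)
have : \forall t \near (0 : R)%R^'+, (ln t < 2 / bl * ln 2^-1 :> R)%R.
  by have /cvgrNyPlt := @lnNy R; apply.
move=> [e2 /= e20 he2].
pose j := Num.bound (Num.min e1 e2)^-1.
have e0 : (0 < Num.min e1 e2)%R by rewrite lt_min e10.
have j0 : (0 < (2 ^ j)%:R :> R)%R by rewrite ltr0n expn_gt0.
have jlt : ((2 ^ j)%:R^-1 < Num.min e1 e2)%R.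
  rewrite invf_plt ?posrE//.
  apply: (@lt_trans _ _ j%:R).
    by apply: archi_boundP; rewrite invr_ge0 ltW.
  by rewrite ltr_nat ltn_expl.
exists j => t /in_I01/andP[t0 t1]; set q := ((2 ^ j)%:R^-1)%R in jlt *.
have q0 : (0 < q)%R by rewrite invr_gt0.
have q1 : (q <= 1)%R by rewrite invf_le1// ler1n expn_gt0.
have /he1 : ball 0%R e1 q.
  by rewrite /ball /= sub0r normrN gtr0_norm// (lt_le_trans jlt)// ge_min lexx.
have /he2 : ball 0%R e2 q.
  by rewrite /ball /= sub0r normrN gtr0_norm// (lt_le_trans jlt)// ge_min lexx orbT.
move=> /(_ q0) lnq /(_ q0) lnm.
have l2 : (ln 2^-1 < 0 :> R)%R by apply: ln_lt0; lra.
have lq0 : (ln q < 0)%R.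
  by apply: (lt_trans lnq); rewrite pmulr_rlt0// divr_gt0.
have m12 : (fine (dilfun psi q) <= 2^-1)%R.
  rewrite -ler_ln ?posrE ?dilfun_gt0 ?invr_gt0//.
  rewrite ltr_ndivlMr// in lnm; apply: (le_trans (ltW lnm)).
  by rewrite mulrC -ler_pdivlMr ?divr_gt0// invf_div mulrC ltW.
have tq1 : (t * q < 1)%R by rewrite (le_lt_trans _ t1)// ler_piMr// ltW.
apply: (le_trans (dilfun_ge psiA _ q0 tq1)); first by rewrite t0.
by rewrite ler_pM2r//; apply: (A0_pos psiA); apply/in_I01; rewrite t0.
Qed.

(** The base [C * (t / s)] is at least one, so its power with exponent [r <= 1] is no
    larger than itself. *)
Lemma weight_almost_decr (R : realType) (r : R) (psi : R -> R) : classA0 psi ->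
  (0 < r)%R -> (r <= 1)%R ->
  exists2 C : R, (1 <= C)%R & forall s t, (0 < s)%R -> (s <= t)%R -> (t < 1)%R ->
    (psi t `^ r / t <= C * (psi s `^ r / s))%R.
Proof.
move=> psiA r0 r1; have [C C1 hC] := psi_div_almost_decr psiA.
exists C => // s t s0 st t1.
have t0 : (0 < t)%R by exact: lt_le_trans st.
have s1 : (s < 1)%R by exact: le_lt_trans t1.
have ps0 : (0 <= psi s)%R by apply/ltW/(A0_pos psiA)/in_I01; rewrite s0.
have pt0 : (0 <= psi t)%R by apply/ltW/(A0_pos psiA)/in_I01; rewrite t0.
have Cts1 : (1 <= C * (t / s))%R by rewrite mulr_ege1// ler_pdivlMr// mul1r.
have Cts0 : (0 <= C * (t / s))%R by rewrite (le_trans _ Cts1).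
rewrite ler_pdivrMr//.
have -> : (C * (psi s `^ r / s) * t = C * (t / s) * psi s `^ r)%R by ring.
apply: (@le_trans _ _ ((C * (t / s) * psi s) `^ r)%R).
  apply: (ge0_ler_powR (ltW r0)); rewrite ?nnegrE//; last exact: hC.
  by rewrite mulr_ge0.
rewrite powRM//; apply: ler_wpM2r; first exact: powR_ge0.
exact: ler1_powR.
Qed.

Lemma measurable_psi (R : realType) (psi : R -> R) : classA0 psi ->
  measurable_fun I01 psi.
Proof.
move=> psiA; apply/measurable_EFinP.
apply: nondecr_measurable => [|s t /in_I01/andP[s0 _] /in_I01/andP[_ t1] st].
  exact: is_interval_I01.
by rewrite lee_fin; exact: (A0_incr psiA).
Qed.

Lemma measurable_weight (R : realType) (r : R) (psi : R -> R) : classA0 psi ->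
  measurable_fun I01 (fun t => psi t `^ r / t)%R.
Proof.
move=> psiA; apply: measurable_funM.
  apply: (measurableT_comp (measurable_powR _)); exact: measurable_psi.
apply/measurable_EFinP.
apply: nonincr_measurable => [|s t /in_I01/andP[s0 _] /in_I01/andP[t0 _] st].
  exact: is_interval_I01.
by rewrite lee_fin lef_pV2 ?posrE.
Qed.

Lemma weight_ge0 (R : realType) (r : R) (psi : R -> R) (t : R) :
  I01 t -> (0 <= psi t `^ r / t)%R.
Proof. by move=> /in_I01/andP[t0 _]; rewrite divr_ge0 ?powR_ge0// ltW. Qed.

(** * Dilations in a rearrangement-invariant space *)

Lemma rho_le (R : realType) (rho : (R -> \bar R) -> \bar R) (f g : R -> \bar R) :
  ri_norm rho -> Mplus f -> Mplus g -> (forall x, I01 x -> f x <= g x) ->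
  rho f <= rho g.
Proof. by move=> [h _] Mf Mg fg; apply: (bfn_mono h) => //; exact: aeW. Qed.

Lemma Xnorm_Mplus (R : realType) (rho : (R -> \bar R) -> \bar R)
    (f : R -> \bar R) : ri_norm rho -> Mplus f -> Xnorm rho f = rho f.
Proof.
move=> hX Mf; have Maf : Mplus (fun x => `|f x|).
  by split => [|x _]; [apply: measurableT_comp => //; exact: Mf.1|].
by apply/eqP; rewrite eq_le; apply/andP; split; apply: (rho_le hX) => // x Ix;
  rewrite gee0_abs ?Mf.2.
Qed.

(** Real values keep such a function in L0, where the norm only depends on the
    rearrangement. *)
Definition decr01 (R : realType) (F : R -> R) : Prop :=
  (forall x, I01 x -> (0 <= F x)%R) /\
  (forall s t, (0 < s)%R -> (s <= t)%R -> (t < 1)%R -> (F t <= F s)%R).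

Lemma decr01_Mplus (R : realType) (F : R -> R) : decr01 F -> Mplus (EFin \o F).
Proof.
move=> [F0 Fd]; split; last by move=> x /F0; rewrite lee_fin.
apply: nonincr_measurable => [|s t /in_I01/andP[s0 _] /in_I01/andP[_ t1] st].
  exact: is_interval_I01.
by rewrite lee_fin; exact: Fd.
Qed.

(** A superlevel set of a nonincreasing function may or may not contain its right
    endpoint. *)
Lemma measure_between_itv (R : realType) (S : set R) (c a : R) :
  measurable S -> (0 <= a)%R -> `]c, (c + a)%R[ `<=` S ->
  S `<=` `]c, (c + a)%R] -> lebesgue_measure S = a%:E.
Proof.
move=> mS a0 lo hi.
have len b : lebesgue_measure [set` Interval (BRight c) (BSide b (c + a)%R)] = a%:E.
  rewrite lebesgue_measure_itv /= lte_fin ltrDl lt_neqAle a0 andbT eq_sym.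
  by case: eqVneq => [->//|_] /=; rewrite -EFinB addrAC subrr add0r.
apply/eqP; rewrite eq_le; apply/andP; split.
  by rewrite -(len false); apply: le_measure; rewrite ?inE.
by rewrite -(len true); apply: le_measure; rewrite ?inE.
Qed.

(** The superlevel sets of a nonincreasing function are initial intervals, so that
    dilating by two doubles their measure.  The same doubling results from placing
    two copies of the first half of the function side by side, and each
    of these copies has the norm of that half. *)
Lemma dilation2_le (R : realType) (rho : (R -> \bar R) -> \bar R) (F : R -> R) :
  ri_norm rho -> decr01 F ->
  rho (fun t => (F (t / 2))%:E) <= 2%:E * rho (EFin \o F).
Proof.
move=> hX dF; have [F0 Fd] := dF; have hb := ri_bfn hX.
pose G t := (F (t / 2)%R)%:E.
(* the first half of F in its place, and a copy of it shifted to (1/2, 1) *)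
pose P1 (t : R) : \bar R := if (t <= 2^-1)%R then (F t)%:E else 0.
pose P2 (t : R) : \bar R := if (t <= 2^-1)%R then 0 else (F (t - 2^-1)%R)%:E.
have half x : I01 x -> I01 (x / 2)%R.
  by move=> /in_I01/andP[x0 x1]; apply/in_I01; lra.
have G0 x : I01 x -> 0 <= G x by move=> /half/F0; rewrite lee_fin.
have P10 x : I01 x -> 0 <= P1 x.
  by move=> Ix; rewrite /P1; case: ifP => // _; rewrite lee_fin F0.
have P20 x : I01 x -> 0 <= P2 x.
  move=> /in_I01/andP[x0 x1]; rewrite /P2; case: (leP x 2^-1%R) => // h.
  by rewrite lee_fin F0//; apply/in_I01; lra.
have mG : meas01 G.
  apply: nonincr_measurable => [|s t /in_I01/andP[s0 s1] /in_I01/andP[t0 t1] st].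
    exact: is_interval_I01.
  by rewrite lee_fin; apply: Fd; lra.
have mP1 : meas01 P1.
  apply: nonincr_measurable => [|s t /[dup] Is /in_I01/andP[s0 s1] /in_I01/andP[t0 t1] st].
    exact: is_interval_I01.
  rewrite /P1; case: ifP => th.
    by rewrite (le_trans st th) lee_fin; apply: Fd.
  by case: ifP => // _; rewrite lee_fin F0.
have mP2 : meas01 P2.
  rewrite /meas01 (_ : I01 = `]0%R, 2^-1%R] `|` `]2^-1%R, 1%R[); last first.
    apply/seteqP; split => x /=.
      move=> /in_I01/andP[x0 x1]; rewrite !in_itv /= x0 x1 andbT /=.
      by case: (leP x 2^-1%R); [left|right].
    by rewrite !in_itv /= => -[/andP[x0 x1]|/andP[x0 x1]]; apply/in_I01; lra.
  apply/measurable_funU => //; split.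
    apply: nonincr_measurable => [|s t]; first exact: interval_is_interval.
    by rewrite /= !in_itv /P2 /= => /andP[_ ->] /andP[_ ->].
  apply: nonincr_measurable => [|s t]; first exact: interval_is_interval.
  rewrite /= !in_itv /P2 /= => /andP[s2 s1] /andP[t2 t1] st.
  rewrite (leNgt s) s2 (leNgt t) t2 /= lee_fin; apply: Fd; lra.
have MP1 : Mplus P1 by [].
have MP2 : Mplus P2 by [].
have MG : Mplus G by [].
have mP : meas01 (fun x => P1 x + P2 x) by exact: emeasurable_funD.
have P0 x : I01 x -> 0 <= P1 x + P2 x by move=> Ix; rewrite adde_ge0// ?P10 ?P20.
have MP : Mplus (fun x => P1 x + P2 x) by [].
have levels (t : R) : (0 < t)%R -> exists a : R, [/\ distr P1 t = a%:E,
    distr P2 t = a%:E, distr (fun x => P1 x + P2 x) t = (a + a)%:E &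
    distr G t = (a + a)%:E].
  move=> t0.
  pose S1 := [set x | I01 x /\ t%:E < `|P1 x|].
  pose S2 := [set x | I01 x /\ t%:E < `|P2 x|].
  have mS1 : measurable S1 by exact: measurable_superlevel.
  have mS2 : measurable S2 by exact: measurable_superlevel.
  have S1E x : S1 x <-> [/\ (0 < x)%R, (x <= 2^-1)%R & (t < F x)%R].
    split.
      move=> [/[dup] Ix /in_I01/andP[x0 x1]]; rewrite gee0_abs ?P10// /P1.
      by case: ifP => // x2; rewrite lte_fin // ltNge ltW.
    move=> [x0 x2 tx]; have Ix : I01 x by apply/in_I01; lra.
    by split => //; rewrite gee0_abs ?P10// /P1 x2 lte_fin.
  have S1d : distr P1 t = (fine (distr P1 t))%:E.
    rewrite fineK// ge0_fin_numE ?distr_ge0//.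
    by rewrite (le_lt_trans (distr_le1 _ mP1))// ltry.
  set a := fine (distr P1 t) in S1d.
  have a0 : (0 <= a)%R by exact/fine_ge0/distr_ge0.
  have S1a x : S1 x -> (x <= a)%R.
    move=> /S1E[x0 x2 tx]; rewrite -lee_fin -S1d//.
    have -> : x%:E = lebesgue_measure `]0%R, x].
      by rewrite lebesgue_measure_itv /= lte_fin x0 EFinN oppe0 adde0.
    apply: le_measure; rewrite ?inE// => y /=; rewrite in_itv /= => /andP[y0 yx].
    apply/S1E; split => //; first lra.
    by apply: (lt_le_trans tx); apply: Fd; lra.
  have aS1 x : (0 < x)%R -> (x < a)%R -> S1 x.
    move=> x0 xa; apply: contrapT => nS.
    suff : (a <= x)%R by rewrite leNgt xa.
    rewrite -lee_fin -S1d//.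
    have -> : x%:E = lebesgue_measure `]0%R, x].
      by rewrite lebesgue_measure_itv /= lte_fin x0 EFinN oppe0 adde0.
    apply: le_measure; rewrite ?inE// => y Sy /=; rewrite in_itv /=.
    move/S1E : (Sy) => [y0 y2 ty]; rewrite y0 /= leNgt; apply/negP => xy.
    apply: nS; apply/S1E; split => //; first lra.
    by apply: (lt_le_trans ty); apply: Fd; lra.
  have a2 : (a <= 2^-1)%R.
    rewrite leNgt; apply/negP => ha.
    have /aS1 : (0 < (2^-1 + a) / 2)%R by lra.
    by case/(_ _)/S1E; lra.
  have S2E x : S2 x <-> [/\ (2^-1 < x)%R, (x < 1)%R & (t < F (x - 2^-1))%R].
    split.
      move=> [/[dup] Ix /in_I01/andP[x0 x1]]; rewrite gee0_abs ?P20// /P2.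
      by case: (leP x 2^-1%R) => x2; rewrite lte_fin // ltNge ltW.
    move=> [x0 x2 tx]; have Ix : I01 x by apply/in_I01; lra.
    by split => //; rewrite gee0_abs ?P20// /P2 leNgt x0 lte_fin.
  have d2 : distr P2 t = a%:E.
    apply: (@measure_between_itv _ S2 2^-1%R) => // x /=.
      rewrite in_itv /= => /andP[x0 xa]; apply/S2E; split => //; first lra.
      by have /S1E[] : S1 (x - 2^-1)%R by apply: aS1; lra.
    move/S2E => [x0 x1 tx]; rewrite in_itv /= x0 /=.
    have /S1a : S1 (x - 2^-1)%R by apply/S1E; split => //; lra.
    lra.
  exists a; split => //.
  - rewrite EFinD -{1}d2 addeC -S1d//.
    rewrite /distr -measureU//; last first.
      apply/seteqP; split => x // -[/S1E[_ x2 _] /S2E[x2' _ _]]; lra.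
    congr lebesgue_measure; apply/seteqP; split => x /=.
      move=> [Ix]; rewrite gee0_abs ?P0// gee0_abs ?P10// gee0_abs ?P20//.
      rewrite /P1 /P2; case: ifP => _; rewrite ?adde0 ?add0e => h; [left|right]; by split.
    move=> [[Ix]|[Ix]]; rewrite gee0_abs ?P10 ?P20// => h; split => //;
    rewrite gee0_abs ?P0//; apply: (lt_le_trans h).
      by rewrite leeDl ?P20.
    by rewrite leeDr ?P10.
  - apply: (@measure_between_itv _ _ 0%R); rewrite ?add0r.
    + exact: measurable_superlevel.
    + exact: addr_ge0.
    + move=> x /=; rewrite in_itv /= => /andP[x0 xa].
      have Ix : I01 x by apply/in_I01; lra.
      split; first exact: Ix.
      rewrite lte_fin ger0_norm; last exact/F0/half.
      by have /S1E[] : S1 (x / 2)%R by apply: aS1; lra.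
    + move=> x [/[dup] Ix /in_I01/andP[x0 x1]]; rewrite gee0_abs ?G0// lte_fin => tx.
      rewrite /= in_itv /= x0 /=.
      have /S1a : S1 (x / 2)%R by apply/S1E; split => //; lra.
      lra.
have XE f : Mplus f -> Xnorm rho f = rho f by exact: Xnorm_Mplus.
have L0fin f : meas01 f -> (forall x, f x \is a fin_num) -> L0 f.
  by move=> mf ff; split => //; apply: aeW => x _.
have P1fin x : P1 x \is a fin_num by rewrite /P1; case: ifP.
have P2fin x : P2 x \is a fin_num by rewrite /P2; case: ifP.
have -> : rho G = rho (fun x => P1 x + P2 x).
  rewrite -!XE//; apply: (ri_rearr hX).
  - exact: L0fin.
  - by apply: L0fin => // x; rewrite fin_numD P1fin P2fin.
  - move=> s _; congr (_ s); apply: eq_rearr => t t0.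
    by have [a [_ _ -> ->]] := levels t t0.
apply: (le_trans (bfn_triangle hb MP1 MP2)).
have <- : rho P1 = rho P2.
  rewrite -!XE//; apply: (ri_rearr hX); [exact: L0fin|exact: L0fin|].
  move=> s _; congr (_ s); apply: eq_rearr => t t0.
  by have [a [-> -> _ _]] := levels t t0.
have P1F : rho P1 <= rho (EFin \o F).
  apply: (rho_le hX) => //; first exact: decr01_Mplus.
  by move=> x Ix; rewrite /P1; case: ifP => //= _; rewrite lee_fin F0.
by rewrite -mule2n mule_natl mule2n leeD.
Qed.

Lemma decr01_dilation (R : realType) (F : R -> R) (N : R) : (1 <= N)%R ->
  decr01 F -> decr01 (fun t => F (t / N)%R).
Proof.
move=> N1 [F0 Fd]; have N0 : (0 < N)%R by exact: lt_le_trans N1.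
have le1 t : (0 < t)%R -> (t / N <= t)%R.
  by move=> t0; rewrite ler_pdivrMr// ler_peMr// ltW.
split.
  move=> x /in_I01/andP[x0 x1]; apply: F0; apply/in_I01.
  by rewrite divr_gt0//= (le_lt_trans (le1 _ x0)).
move=> s t s0 st t1; apply: Fd; first by rewrite divr_gt0.
  by rewrite ler_pM2r ?invr_gt0.
by rewrite (le_lt_trans (le1 _ _))// (lt_le_trans s0).
Qed.

Lemma dilation_le (R : realType) (rho : (R -> \bar R) -> \bar R) (F : R -> R)
    (j : nat) : ri_norm rho -> decr01 F ->
  rho (fun t => (F (t / (2 ^ j)%:R))%:E) <= (2 ^ j)%:R%:E * rho (EFin \o F).
Proof.
move=> hX; elim: j F => [|j IH] F dF.
  rewrite mul1e; under eq_fun do rewrite expn0 divr1.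
  by [].
have dF2 : decr01 (fun t => F (t / 2)%R) by apply: decr01_dilation => //; lra.
have -> : (fun t => (F (t / (2 ^ j.+1)%:R)%R)%:E) =
    (fun t => (F (t / (2 ^ j)%:R / 2)%R)%:E).
  by apply/funext => t; rewrite expnS natrM invfM mulrA mulrAC.
apply: (le_trans (IH _ dF2)).
rewrite expnS natrM [in leRHS]mulrC EFinM -muleA; apply: lee_wpmul2l.
  by rewrite lee_fin.
exact: dilation2_le.
Qed.

(** * A Hardy operator on nonincreasing functions *)

Lemma norm_cst1_fin (R : realType) (rho : (R -> \bar R) -> \bar R) :
  ri_norm rho -> exists2 y : R, (0 <= y)%R & rho (cst 1) = y%:E.
Proof.
move=> hX; have hb := ri_bfn hX.
have M1 : Mplus (cst 1 : R -> \bar R) by split => // ; exact: measurable_cst.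
have MI : Mplus (fun x : R => (\1_(@I01 R) x)%:E).
  split; last by move=> x _; rewrite lee_fin.
  by apply/measurable_EFinP; apply: measurable_indic; exact: measurable_I01.
have h : rho (cst 1) <= rho (fun x => (\1_I01 x)%:E).
  by apply: (rho_le hX) => // x Ix; rewrite indicE mem_set.
have r0 : 0 <= rho (cst 1) by exact: (bfn_ge0 hb).
exists (fine (rho (cst 1))); first exact: fine_ge0.
rewrite fineK// ge0_fin_numE//; apply: (le_lt_trans h).
by apply: (bfn_indic hb) => //; exact: measurable_I01.
Qed.

Lemma itv_subI01 (R : realType) (b : bool) (s t : R) : (0 <= s)%R -> I01 t ->
  [set` Interval (BRight s) (BSide b t)] `<=` I01.
Proof.
move=> s0 /in_I01/andP[t0 t1] x /=; rewrite in_itv /= => /andP[sx xt].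
apply/in_I01; rewrite (le_lt_trans s0 sx)/=.
by case: b xt => [/lt_trans|/le_lt_trans]; apply.
Qed.

Lemma integral_le_cst_itv (R : realType) (f : R -> R) (s t K : R) :
  (s <= t)%R -> measurable_fun `]s, t] f ->
  (forall x, (s < x)%R -> (x <= t)%R -> (0 <= f x <= K)%R) ->
  \int[lebesgue_measure]_(x in `]s, t]) (f x)%:E <= (K * (t - s))%:E.
Proof.
move=> st mf fK.
have -> : (K * (t - s))%:E = \int[lebesgue_measure]_(x in `]s, t]) (cst K%:E x).
  rewrite integral_cst//= lebesgue_measure_itv /= lte_fin lt_neqAle st andbT.
  by case: eqVneq => [->|_]; rewrite ?subrr ?mulr0 ?mule0//= -EFinB -EFinM.
apply: ge0_le_integral => //.
- by move=> x /=; rewrite in_itv /= => /andP[sx /(fK _ sx)/andP[]]; rewrite lee_fin.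
- exact/measurable_EFinP.
- by move=> x /=; rewrite in_itv /= => /andP[sx /(fK _ sx)/andP[_]]; rewrite lee_fin.
Qed.

(** With [T F t] the mean of [F * psi] over [(0, t)] divided by [psi t], splitting
    the mean at [t / N] gives [T F t <= F (t / N) + T F (t / N) / (2 * N)] as soon
    as [psi (t / N) <= psi t / 2].  The iterates of this recursion from a constant
    are nonincreasing majorants of [T F]; the dilation estimate makes the recursion a
    contraction of ratio [1 / 2] on their norms. *)
Lemma hardy_majorant (R : realType) (rho : (R -> \bar R) -> \bar R)
    (psi : R -> R) : ri_norm rho -> classA0 psi ->
  exists2 M : R, (0 < M)%R & forall (F : R -> R) (c : R), decr01 F ->
    (forall x, I01 x -> (F x <= c)%R) -> rho (EFin \o F) <= 1 ->
    exists S : R -> R, [/\ decr01 S,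
      forall t, I01 t ->
        \int[lebesgue_measure]_(s in `]0%R, t]) (F s * psi s)%:E <=
        (S t * t * psi t)%:E &
      rho (EFin \o S) <= M%:E].
Proof.
move=> hX psiA; have hb := ri_bfn hX.
have [j hj] := psi_halving psiA.
have [y y0 hy] := norm_cst1_fin hX.
pose N : R := (2 ^ j)%:R.
have N1 : (1 <= N)%R by rewrite ler1n expn_gt0.
have N0 : (0 < N)%R by exact: lt_le_trans N1.
have N20 : (0 < 2 * N)%R by rewrite mulr_gt0.
have psi0 t : I01 t -> (0 < psi t)%R by exact: (A0_pos psiA).
exists (2 * N + 1)%R; first by rewrite addr_gt0.
move=> F c dF Fc F1; have [F0 Fd] := dF.
have c0 : (0 <= c)%R.
  have I2 : I01 (2^-1 : R)%R by apply/in_I01; lra.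
  exact: le_trans (F0 _ I2) (Fc _ I2).
pose S := fix S K : R -> R := match K with
  | 0 => cst c
  | K'.+1 => fun t => (F (t / N) + (2 * N)^-1 * S K' (t / N))%R end.
have dS K : decr01 (S K).
  elim: K => [|K IH]; first by split.
  have [FN0 FNd] := decr01_dilation N1 dF.
  have [SN0 SNd] := decr01_dilation N1 IH.
  split => [x Ix|s t s0 st t1] /=.
    by rewrite addr_ge0 ?FN0// mulr_ge0 ?SN0// invr_ge0 ltW.
  by rewrite lerD ?FNd// ler_pM2l ?invr_gt0// SNd.
have divN t : I01 t -> I01 (t / N)%R /\ (t / N <= t)%R.
  move=> /in_I01/andP[t0 t1].
  have tN : (t / N <= t)%R by rewrite ler_pdivrMr// ler_peMr// ltW.
  by split => //; apply/in_I01; rewrite divr_gt0//= (le_lt_trans tN).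
have mFp : measurable_fun I01 (fun s => F s * psi s)%R.
  apply: measurable_funM; last exact: measurable_psi.
  by apply/measurable_EFinP; exact: (decr01_Mplus dF).1.
have mFpS (s t : R) : (0 <= s)%R -> I01 t -> measurable_fun `]s, t] (fun s => F s * psi s)%R.
  move=> s0 It; apply: (measurable_funS _ _ mFp); first exact: measurable_I01.
  exact: itv_subI01.
have TS K t : I01 t ->
    \int[lebesgue_measure]_(s in `]0%R, t]) (F s * psi s)%:E <=
    (S K t * t * psi t)%:E.
  elim: K t => [|K IH] t It; have /in_I01/andP[t0 t1] := It.
    have -> : (S 0%N t * t * psi t = (c * psi t) * (t - 0))%R by rewrite /=; ring.
    apply: integral_le_cst_itv; [exact: ltW|exact: mFpS|].
    move=> x x0 xt; have Ix : I01 x by apply/in_I01; rewrite x0 (le_lt_trans xt).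
    rewrite mulr_ge0 ?F0 ?(ltW (psi0 _ _))//= ler_pM ?F0 ?Fc ?(ltW (psi0 _ _))//.
    exact: (A0_incr psiA).
  have [ItN tNt] := divN t It; have /in_I01/andP[tN0 tN1] := ItN.
  have -> : `]0%R, t]%classic = `]0%R, (t / N)%R] `|` `](t / N)%R, t].
    apply/seteqP; split => x /=; rewrite !in_itv /=.
      by move=> /andP[x0 xt]; case: (leP x (t / N)%R) => h; [left|right]; rewrite ?x0 ?h.
    by move=> [/andP[-> /le_trans ->//]|/andP[h ->]]; rewrite (lt_trans tN0 h).
  rewrite ge0_integral_setU//=; last 3 first.
  - apply/measurable_EFinP/measurable_funU => //.
    by split; apply: mFpS => //; exact: ltW.
  - have sub := itv_subI01 (b := false) (lexx 0%R) It.
    have sub' := itv_subI01 (b := false) (lexx 0%R) ItN.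
    have sub2 := itv_subI01 (b := false) (ltW tN0) It.
    by move=> x [/sub'|/sub2] Ix; rewrite lee_fin mulr_ge0 ?F0// ltW// psi0.
  - rewrite disj_set2E; apply/eqP/seteqP; split => x //=; rewrite !in_itv /=.
    by move=> [/andP[_ xN] /andP[Nx _]]; move: (le_lt_trans xN Nx); rewrite ltxx.
  apply: (@le_trans _ _ ((S K (t / N) * (t / N) * psi (t / N))%:E +
      (F (t / N) * psi t * (t - t / N))%:E)).
    apply: leeD; first exact: IH.
    apply: integral_le_cst_itv => //; first by apply: mFpS => //; exact: ltW.
    move=> x x0 xt; have Ix : I01 x.
      by apply/in_I01; rewrite (lt_trans tN0 x0) (le_lt_trans xt).
    rewrite mulr_ge0 ?F0 ?(ltW (psi0 _ _))//= ler_pM ?F0 ?(ltW (psi0 _ _))//.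
      by apply: Fd => //; [exact: ltW|exact: le_lt_trans t1].
    by apply: (A0_incr psiA) => //; exact: lt_trans x0.
  rewrite -EFinD lee_fin /=.
  have -> : ((F (t / N) + (2 * N)^-1 * S K (t / N)) * t * psi t =
     S K (t / N) * (t / N) * (2^-1 * psi t) + F (t / N) * psi t * t)%R.
    by field; rewrite gt_eqF.
  apply: lerD.
    apply: ler_wpM2l; last exact: hj.
    by rewrite mulr_ge0 ?(ltW tN0)// (dS K).1.
  apply: ler_wpM2l; last by rewrite gerBl ltW.
  by rewrite mulr_ge0 ?F0// ltW// psi0.
have rS K : rho (EFin \o S K) <= (2 * N + (2 ^+ K)^-1 * (c * y))%:E.
  elim: K => [|K IH].
    have -> : EFin \o S 0%N = fun x => c%:E * cst 1 x.
      by apply/funext => x /=; rewrite mule1.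
    rewrite (bfn_scale hb)//; last by split => // ; exact: measurable_cst.
    by rewrite hy -EFinM lee_fin expr0 invr1 mul1r lerDr ltW.
  have dFN := decr01_dilation N1 dF.
  have dSN := decr01_dilation N1 (dS K).
  have -> : EFin \o S K.+1 = fun t => (F (t / N))%:E +
      ((2 * N)^-1%:E * (S K (t / N))%:E).
    by apply/funext => t /=; rewrite EFinD EFinM.
  have Msc : Mplus (fun t => ((2 * N)^-1)%:E * (S K (t / N))%:E).
    have [m p] := decr01_Mplus dSN; split; first exact: measurable_funeM.
    by move=> x Ix; rewrite mule_ge0 ?p// lee_fin invr_ge0 ltW.
  apply: (le_trans (bfn_triangle hb (decr01_Mplus dFN) Msc)).
  rewrite (bfn_scale hb) ?invr_ge0 ?(ltW N20)//; last exact: decr01_Mplus dSN.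
  have h1 : rho (fun t => (F (t / N))%:E) <= N%:E.
    apply: (le_trans (dilation_le j hX dF)).
    by rewrite -[leRHS]mule1; apply: lee_wpmul2l => //; rewrite lee_fin ltW.
  have h2 : rho (fun t => (S K (t / N))%:E) <= (N * (2 * N + (2 ^+ K)^-1 * (c * y)))%:E.
    apply: (le_trans (dilation_le j hX (dS K))).
    by rewrite EFinM; apply: lee_wpmul2l => //; rewrite lee_fin ltW.
  apply: (@le_trans _ _ (N%:E + (2 * N)^-1%:E * (N * (2 * N + (2 ^+ K)^-1 * (c * y)))%:E)).
    apply: leeD => //; apply: lee_wpmul2l => //.
    by rewrite lee_fin invr_ge0 ltW.
  rewrite -EFinM -EFinD lee_fin exprS invfM.
  rewrite le_eqVlt; apply/orP; left; apply/eqP; field.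
  by rewrite gt_eqF//= expf_neq0// pnatr_eq0.
(* so many steps that the contribution of the constant start is at most one *)
pose K := Num.bound (c * y)%R.
exists (S K); split => //; first exact: TS.
apply: (le_trans (rS K)); rewrite lee_fin lerD2l.
have K0 : (0 < 2 ^+ K :> R)%R by rewrite exprn_gt0.
rewrite mulrC ler_pdivrMr// mul1r.
apply: (@le_trans _ _ K%:R).
  by apply/ltW/archi_boundP; rewrite mulr_ge0.
by rewrite -natrX ler_nat ltnW// ltn_expl.
Qed.

(** A crude form of Jensen's inequality, from
    [y `^ r <= A `^ r + A `^ (r - 1) * y] *)
Lemma mean_powR_le (R : realType) (phi : R -> R) (r t A : R) :
  (0 < r)%R -> (r <= 1)%R -> (0 < A)%R -> I01 t -> measurable_fun I01 phi ->
  (forall x, I01 x -> (0 <= phi x)%R) ->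
  \int[lebesgue_measure]_(s in `]0%R, t]) (phi s)%:E <= (A * t)%:E ->
  \int[lebesgue_measure]_(s in `]0%R, t]) (phi s `^ r)%:E <= (2 * A `^ r * t)%:E.
Proof.
move=> r0 r1 A0 It mphi phi0 hA; have /in_I01/andP[t0 t1] := It.
have sub := itv_subI01 (b := false) (lexx 0%R) It.
have mphiS : measurable_fun `]0%R, t] phi.
  by apply: (measurable_funS _ sub mphi); exact: measurable_I01.
have Ar0 : (0 <= A `^ r)%R by exact: powR_ge0.
have pt (x : R) : I01 x -> (phi x `^ r <= A `^ r + A `^ r / A * phi x)%R.
  move=> Ix; have px := phi0 _ Ix.
  have [pA|Ap] := leP (phi x) A.
    apply: (@le_trans _ _ (A `^ r)%R).
      by apply: (ge0_ler_powR (ltW r0)); rewrite ?nnegrE// ltW.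
    by rewrite lerDl !mulr_ge0// invr_ge0 ltW.
  apply: (@le_trans _ _ (A `^ r / A * phi x)%R); last by rewrite lerDr.
  have -> : phi x = (A * (phi x / A))%R by rewrite mulrCA divff ?gt_eqF// mulr1.
  have pA0 : (0 <= phi x / A)%R by rewrite divr_ge0// ltW.
  rewrite powRM ?(ltW A0)// -mulrA mulKf ?gt_eqF//; apply: ler_wpM2l => //.
  by apply: ler1_powR => //; rewrite ler_pdivlMr// mul1r ltW.
apply: (@le_trans _ _ (\int[lebesgue_measure]_(s in `]0%R, t])
    (cst (A `^ r)%:E s + (A `^ r / A)%:E * (phi s)%:E))).
  apply: ge0_le_integral => //.
  - by move=> x _; rewrite lee_fin powR_ge0.
  - by apply/measurable_EFinP; apply: (measurableT_comp (measurable_powR _)).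
  - apply: emeasurable_funD => //; apply: measurable_funeM; exact/measurable_EFinP.
  - by move=> x /sub Ix /=; rewrite -EFinM -EFinD lee_fin pt.
rewrite ge0_integralD//; last 2 first.
- by move=> x /sub/phi0 p0; rewrite -EFinM lee_fin !mulr_ge0// invr_ge0 ltW.
- by apply: measurable_funeM; exact/measurable_EFinP.
rewrite ge0_integralZl//; last 3 first.
- exact/measurable_EFinP.
- by move=> x /sub/phi0; rewrite lee_fin.
- by rewrite lee_fin mulr_ge0// invr_ge0 ltW.
apply: (@le_trans _ _ ((A `^ r * t)%:E + (A `^ r / A)%:E * (A * t)%:E)).
  apply: leeD.
    rewrite integral_cst//= lebesgue_measure_itv /= lte_fin t0.
    by rewrite EFinN oppe0 adde0 -EFinM.
  by apply: lee_wpmul2l => //; rewrite lee_fin mulr_ge0// invr_ge0 ltW.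
rewrite -EFinM -EFinD lee_fin le_eqVlt; apply/orP; left; apply/eqP.
by field; rewrite gt_eqF.
Qed.

(** * Tail integrals and their oscillation *)

(** The intersection with (0,1) makes the tail nonnegative and nonincreasing on the
    whole line. *)
Definition tail (R : realType) (p : R -> R) (x : R) : \bar R :=
  \int[lebesgue_measure]_(s in I01 `&` [set s | (x < s)%R]) (p s)%:E.

Lemma measurable_I01_gt (R : realType) (x : R) :
  measurable (I01 `&` [set s : R | (x < s)%R]).
Proof.
apply: measurableI; first exact: measurable_I01.
rewrite (_ : [set s | _] = `]x, +oo[%classic); first exact: measurable_itv.
by apply/seteqP; split => s /=; rewrite in_itv /= andbT.
Qed.

Lemma tail_ge0 (R : realType) (p : R -> R) (x : R) :
  (forall s, I01 s -> (0 <= p s)%R) -> 0 <= tail p x.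
Proof. by move=> p0; apply: integral_ge0 => s [/p0]; rewrite lee_fin. Qed.

Lemma measurable_tail_dom (R : realType) (p : R -> R) (x : R) :
  measurable_fun I01 p ->
  measurable_fun (I01 `&` [set s | (x < s)%R]) (fun s => (p s)%:E).
Proof.
move=> mp; apply/measurable_EFinP; apply: (measurable_funS _ _ mp).
  exact: measurable_I01.
by move=> s [].
Qed.

Lemma tail_mono (R : realType) (p : R -> R) (x y : R) :
  measurable_fun I01 p -> (forall s, I01 s -> (0 <= p s)%R) ->
  (x <= y)%R -> tail p y <= tail p x.
Proof.
move=> mp p0 xy; apply: ge0_subset_integral.
- exact: measurable_I01_gt.
- exact: measurable_I01_gt.
- exact: measurable_tail_dom.
- by move=> s [/p0]; rewrite lee_fin.
- by move=> s [Is /= ys]; split => //=; exact: le_lt_trans ys.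
Qed.

Lemma tail_split (R : realType) (p : R -> R) (x y : R) :
  measurable_fun I01 p -> (forall s, I01 s -> (0 <= p s)%R) ->
  I01 x -> I01 y -> (x <= y)%R ->
  tail p x = \int[lebesgue_measure]_(s in `]x, y]) (p s)%:E + tail p y.
Proof.
move=> mp p0 Ix Iy xy; rewrite /tail -ge0_integral_setU//=.
- congr integral; apply/seteqP; split => s /=; rewrite in_itv /=.
    by move=> [Is xs]; case: (leP s y) => h; [left; rewrite xs|right].
  have /in_I01/andP[x0 _] := Ix; have /in_I01/andP[_ y1] := Iy.
  move=> [/andP[xs sy]|[Is ys]]; split => //; last exact: le_lt_trans ys.
  by apply/in_I01; rewrite (lt_trans x0 xs) (le_lt_trans sy).
- exact: measurable_I01_gt.
- apply/measurable_EFinP; apply: (measurable_funS _ _ mp); first exact: measurable_I01.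
  have /in_I01/andP[x0 _] := Ix.
  by move=> s [/(itv_subI01 (b := false) (ltW x0) Iy)//|[]].
- have /in_I01/andP[x0 _] := Ix.
  by move=> s [/(itv_subI01 (b := false) (ltW x0) Iy)/p0//|[/p0]]; rewrite lee_fin.
- rewrite disj_set2E; apply/eqP/seteqP; split => s //=; rewrite in_itv /=.
  by move=> [/andP[_ sy] [_ ys]]; move: (le_lt_trans sy ys); rewrite ltxx.
Qed.

Lemma tail_le (R : realType) (p : R -> R) (K x : R) :
  measurable_fun I01 p -> (forall s, I01 s -> (0 <= p s <= K / s)%R) ->
  (0 <= K)%R -> I01 x -> tail p x <= (K / x)%:E.
Proof.
move=> mp pK K0 /[dup] Ix /in_I01/andP[x0 x1].
have Kx0 : (0 <= K / x)%R by rewrite divr_ge0// ltW.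
apply: (@le_trans _ _ (\int[lebesgue_measure]_(s in I01 `&` [set s | (x < s)%R])
   cst (K / x)%:E s)).
  apply: ge0_le_integral => //.
  - exact: measurable_I01_gt.
  - by move=> s [/pK/andP[p0 _] _]; rewrite lee_fin.
  - exact: measurable_tail_dom.
  - move=> s [Is /= xs]; rewrite lee_fin.
    have /andP[_ /le_trans] := pK _ Is; apply.
    have /in_I01/andP[s0 _] := Is.
    by apply: ler_wpM2l => //; rewrite lef_pV2 ?posrE// ltW.
rewrite integral_cst; last exact: measurable_I01_gt.
rewrite -[leRHS]mule1; apply: lee_wpmul2l; first by rewrite lee_fin.
have <- : lebesgue_measure (@I01 R) = 1.
  by rewrite /I01 lebesgue_measure_itv /= lte_fin ltr01 EFinN oppe0 adde0.
apply: le_measure; rewrite ?inE.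
- exact: measurable_I01_gt.
- exact: measurable_I01.
- by move=> s [].
Qed.

Lemma tail_meas01 (R : realType) (p : R -> R) :
  measurable_fun I01 p -> (forall s, I01 s -> (0 <= p s)%R) -> meas01 (tail p).
Proof.
move=> mp p0; apply: nonincr_measurable => [|s t _ _ st].
  exact: is_interval_I01.
exact: tail_mono.
Qed.

(** The rearrangement is the right-continuous version of a nonincreasing function,
    and the tail is continuous because its integrand is bounded on (x,1) for [x > 0]. *)
Lemma rearr_tail (R : realType) (p : R -> R) (K s : R) :
  measurable_fun I01 p -> (forall s, I01 s -> (0 <= p s <= K / s)%R) ->
  (0 <= K)%R -> I01 s -> rearr (tail p) s = tail p s.
Proof.
move=> mp pK K0 /[dup] Is /in_I01/andP[s0 s1].
have p0 x : I01 x -> (0 <= p x)%R by move=> /pK/andP[].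
have h0 x : 0 <= tail p x by exact: tail_ge0.
have mh := tail_meas01 mp p0.
apply: ge0_eq_by_lt => //; first exact: rearr_ge0.
move=> l l0; rewrite lt_rearr//; apply/idP/idP => [sd|ls].
  rewrite ltNge; apply/negP => hl.
  suff : distr (tail p) l <= s%:E by rewrite leNgt sd.
  have -> : s%:E = lebesgue_measure `]0%R, s].
    by rewrite lebesgue_measure_itv /= lte_fin s0 EFinN oppe0 adde0.
  apply: le_measure; rewrite ?inE//; first exact: measurable_superlevel.
  move=> x [/in_I01/andP[x0 x1]]; rewrite gee0_abs// => lx.
  rewrite /= in_itv /= x0 /= leNgt; apply/negP => sx.
  have := le_trans (tail_mono mp p0 (ltW sx)) hl.
  by rewrite leNgt lx.
have hf : tail p s \is a fin_num.
  by rewrite ge0_fin_numE// (le_lt_trans (tail_le mp pK K0 Is))// ltry.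
set a := fine (tail p s); have ha : tail p s = a%:E by rewrite fineK.
have la : (l < a)%R by rewrite -lte_fin -ha.
(* On (s, s + d) the integrand is at most [K / s], so that the tail loses less than
   [a - l] there. *)
pose d := Num.min ((1 - s) / 2)%R ((a - l) / (2 * (K / s + 1)))%R.
have Ks0 : (0 <= K / s)%R by rewrite divr_ge0// ltW.
have Ks1 : (0 < K / s + 1)%R by rewrite ltr_wpDl.
have d0 : (0 < d)%R.
  by rewrite lt_min; apply/andP; split; rewrite divr_gt0 ?mulr_gt0 ?subr_gt0.
have d1 : (d <= (1 - s) / 2)%R by rewrite ge_min lexx.
have d2 : (d <= (a - l) / (2 * (K / s + 1)))%R by rewrite ge_min lexx orbT.
have Isd : I01 (s + d)%R by apply/in_I01; lra.
have ssd : (s <= s + d)%R by rewrite lerDl ltW.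
have lsd : l%:E < tail p (s + d).
  rewrite ltNge; apply/negP => hl; move: ls.
  rewrite ltNge => /negP; apply; rewrite ha.
  have : a%:E <= (K / s * (s + d - s))%:E + l%:E.
    rewrite -ha (tail_split mp p0 Is Isd ssd); apply: leeD => //.
    apply: integral_le_cst_itv => //.
      apply: (measurable_funS _ (itv_subI01 (b := false) (ltW s0) Isd) mp).
      exact: measurable_I01.
    move=> x sx xsd; have Ix : I01 x.
      by apply: (itv_subI01 (b := false) (ltW s0) Isd); rewrite /= in_itv /= sx.
    have /andP[-> /le_trans] := pK _ Ix; apply.
    by apply: ler_wpM2l => //; rewrite lef_pV2 ?posrE//; [exact: ltW|exact: lt_trans sx].
  rewrite -EFinD !lee_fin => h.
  have : (K / s * d <= (a - l) / 2)%R.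
    apply: (@le_trans _ _ ((K / s + 1) * d)%R).
      by rewrite ler_pM2r// lerDl.
    rewrite mulrC -ler_pdivlMr//; apply: (le_trans d2).
    by rewrite invfM mulrA.
  move: h; rewrite [(s + d)%R]addrC addrK; lra.
apply: (@lt_le_trans _ _ (s + d)%:E); first by rewrite lte_fin ltrDl.
have -> : (s + d)%:E = lebesgue_measure `]0%R, (s + d)%R].
  by rewrite lebesgue_measure_itv /= lte_fin (lt_le_trans s0 ssd) EFinN oppe0 adde0.
apply: le_measure; rewrite ?inE//; first exact: measurable_superlevel.
move=> x Hx; split.
  exact: (itv_subI01 (b := false) (lexx 0%R) Isd).
rewrite gee0_abs//; apply: (lt_le_trans lsd); apply: tail_mono => //.
by move: Hx; rewrite /= in_itv /= => /andP[].
Qed.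

Lemma integral_tail (R : realType) (p : R -> R) (t : R) :
  measurable_fun I01 p -> (forall s, I01 s -> (0 <= p s)%R) ->
  (0 < t)%R ->
  \int[lebesgue_measure]_(u in `]0%R, t[) tail p u =
  \int[lebesgue_measure]_(s in I01) (p s * Num.min s t)%:E.
Proof.
move=> mp p0 t0.
pose A := [set z : measurableTypeR R * measurableTypeR R | z.1%:E < z.2%:E].
have mA : measurable A.
  rewrite -[X in measurable X]setTI; apply: measurable_lte => //.
    exact/measurable_EFinP.
  exact/measurable_EFinP.
have := @tonelli_region _ (`]0%R, t[%classic : set R) I01 A (cst 1) (EFin \o p)
  (measurable_itv _) (@measurable_I01 _) mA (measurable_cst _) _ (fun _ _ => lee01).
move=> /(_ (ltac:(exact/measurable_EFinP))) H.
have {}H := H (ltac:(by move=> x /p0; rewrite lee_fin)).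
transitivity (\int[lebesgue_measure]_(x in (`]0%R, t[%classic : set R)) (cst 1 x *
    \int[lebesgue_measure]_(y in I01 `&` xsection A x) (EFin \o p) y)).
  apply: eq_integral => u _; rewrite mul1e; congr integral.
  by apply/seteqP; split => s [Is]; rewrite /xsection /A /= inE /= lte_fin.
rewrite H; apply: eq_integral => s; rewrite inE => /in_I01/andP[s0 s1].
rewrite EFinM; congr (_ * _).
rewrite (_ : `]0%R, t[%classic `&` ysection A s = `]0%R, Num.min s t[%classic).
  rewrite integral_one; last exact: measurable_itv.
  rewrite lebesgue_measure_itv /= lte_fin lt_min s0 t0 /=.
  by rewrite EFinN oppe0 adde0.
apply/seteqP; split => u /=; rewrite /ysection /A /= !in_itv /= inE /= lte_fin lt_min.
  by move=> [/andP[-> ->] ->].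
by move=> /and3P[-> -> ->].
Qed.

Lemma integral_tail_I01 (R : realType) (p : R -> R) :
  measurable_fun I01 p -> (forall s, I01 s -> (0 <= p s)%R) ->
  \int[lebesgue_measure]_(u in I01) tail p u =
  \int[lebesgue_measure]_(s in I01) (p s * s)%:E.
Proof.
move=> mp p0; rewrite integral_tail//; apply: eq_integral => s.
rewrite inE => /in_I01/andP[s0 s1]; congr (_ * _)%:E.
by rewrite min_l// ltW.
Qed.

Lemma integral_tail_itv (R : realType) (p : R -> R) (t : R) :
  measurable_fun I01 p -> (forall s, I01 s -> (0 <= p s)%R) -> I01 t ->
  \int[lebesgue_measure]_(u in `]0%R, t[) tail p u =
  \int[lebesgue_measure]_(s in `]0%R, t]) (p s * s)%:E + t%:E * tail p t.
Proof.
move=> mp p0 It; have /in_I01/andP[t0 t1] := It.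
have sub := itv_subI01 (b := false) (lexx 0%R) It.
rewrite integral_tail//.
rewrite (_ : I01 = `]0%R, t] `|` (I01 `&` [set s | (t < s)%R])); last first.
  apply/seteqP; split => s.
    move=> /[dup] Is /in_I01/andP[s0 s1]; case: (leP s t) => h; [left|right] => //.
    by rewrite /= in_itv /= s0.
  by move=> [/sub|[]].
rewrite ge0_integral_setU//=; last 4 first.
- exact: measurable_I01_gt.
- apply/measurable_EFinP.
  apply: (@measurable_funS _ _ _ _ I01); first exact: measurable_I01.
    by move=> s [/sub|[]].
  apply: measurable_funM => //; apply: measurable_minr => //.
- move=> s Hs; have Is : I01 s by case: Hs => [/sub|[]].
  have /in_I01/andP[s0 s1] := Is.
  by rewrite lee_fin mulr_ge0 ?p0// le_min !ltW.
- rewrite disj_set2E; apply/eqP/seteqP; split => s //=; rewrite in_itv /=.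
  by move=> [/andP[_ sy] [_ ys]]; move: (le_lt_trans sy ys); rewrite ltxx.
congr (_ + _).
  apply: eq_integral => s; rewrite inE /= in_itv /= => /andP[_ st].
  by rewrite min_l.
rewrite /tail -ge0_integralZl//; last 4 first.
- exact: measurable_I01_gt.
- exact: measurable_tail_dom.
- by move=> s [/p0]; rewrite lee_fin.
- by rewrite lee_fin ltW.
apply: eq_integral => s; rewrite inE => -[_ /= ts].
by rewrite -EFinM min_r ?(ltW ts)// mulrC.
Qed.

(** Integrating the tail over (0,t) weights the integrand at [s] by the minimum of [s]
    and [t]; the part beyond [t] gives back the tail at [t]. *)
Lemma osc_tail (R : realType) (p : R -> R) (K t : R) :
  measurable_fun I01 p -> (forall s, I01 s -> (0 <= p s <= K / s)%R) ->
  (0 <= K)%R -> I01 t ->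
  maxrearr (tail p) t - rearr (tail p) t =
  t^-1%:E * \int[lebesgue_measure]_(s in `]0%R, t]) (p s * s)%:E.
Proof.
move=> mp pK K0 It; have /in_I01/andP[t0 t1] := It.
have p0 x : I01 x -> (0 <= p x)%R by move=> /pK/andP[].
have sub := itv_subI01 (b := true) (lexx 0%R) It.
have h0 x : 0 <= tail p x by exact: tail_ge0.
have hf : tail p t \is a fin_num.
  by rewrite ge0_fin_numE// (le_lt_trans (tail_le mp pK K0 It))// ltry.
have Q0 : 0 <= \int[lebesgue_measure]_(s in `]0%R, t]) (p s * s)%:E.
  apply: integral_ge0 => s /(itv_subI01 (b := false) (lexx 0%R) It) Is.
  have /in_I01/andP[s0 s1] := Is.
  by rewrite lee_fin mulr_ge0 ?p0// ltW.
rewrite /maxrearr (rearr_tail mp pK K0 It).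
have -> : \int[lebesgue_measure]_(s in `]0%R, t[) rearr (tail p) s =
    \int[lebesgue_measure]_(s in `]0%R, t[) tail p s.
  apply: eq_integral => s; rewrite inE => /sub Is.
  exact: (rearr_tail mp pK K0 Is).
rewrite integral_tail_itv// ge0_muleDr ?mule_ge0 ?lee_fin ?(ltW t0)//.
by rewrite muleA -EFinM mulVf ?gt_eqF// mul1e addeK.
Qed.

(** * From the embedding to bounded tails *)

Lemma Lp01E (R : realType) (r : R) (f : R -> \bar R) : (0 < r)%R ->
  Lp01 r%:E f = (\int[lebesgue_measure]_(x in I01) abspow r f x) `^ r^-1.
Proof.
move=> r0; rewrite /Lp01 unlock; congr (_ `^ _).
rewrite [RHS]integral_mkcond; apply: eq_integral => x _.
by rewrite !patchE /abspow; case: ifP => // _; rewrite abse0 poweR0r// gt_eqF.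
Qed.

Lemma Lp01yP (R : realType) (f : R -> \bar R) (M : \bar R) : 0 <= M ->
  Lp01 +oo f <= M <->
  \forall x \ae lebesgue_measure, I01 x -> `|f x| <= M.
Proof.
move=> M0; rewrite /Lp01 unlock.
have -> : (0 < lebesgue_measure [set: R]) = true.
  by rewrite -set_itvNyy lebesgue_measure_itv /= ltry.
split.
  move/ess_supP; apply: filterS => x /=; rewrite patchE => h Ix.
  by move: h; rewrite mem_set.
move=> [N [mN N0 hN]]; apply/ess_supP; exists N; split => // x /= nx.
apply: hN => /= h; apply: nx; rewrite patchE.
by case: ifPn => [|_]; [rewrite inE => /h|rewrite abse0].
Qed.

Lemma maxrearr_measurable (R : realType) (g : R -> \bar R) : meas01 (maxrearr g).
Proof.
apply: emeasurable_funM.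
  apply: nonincr_measurable => [|s t /in_I01/andP[s0 _] /in_I01/andP[t0 _] st].
    exact: is_interval_I01.
  by rewrite lee_fin lef_pV2 ?posrE.
apply: nondecr_measurable => [|s t /in_I01/andP[s0 s1] It st].
  exact: is_interval_I01.
apply: ge0_subset_integral => //.
- apply: (measurable_funS _ _ (measurable_rearr g)); first exact: measurable_I01.
  exact: (itv_subI01 (b := true) (lexx 0%R) It).
- by move=> x _; exact: rearr_ge0.
- by move=> x /=; rewrite !in_itv /= => /andP[-> xs]; exact: lt_le_trans st.
Qed.

Lemma osc_measurable (R : realType) (r : R) (f : R -> \bar R) : meas01 (osc r f).
Proof.
apply: emeasurable_funB; [exact: maxrearr_measurable|exact: measurable_rearr].
Qed.

Lemma osc_quotient_measurable (R : realType) (r : R) (f : R -> \bar R)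
    (psi : R -> R) : classA0 psi ->
  meas01 (fun t => osc r f t `^ r^-1 * (psi t)^-1%:E).
Proof.
move=> psiA; apply: emeasurable_funM.
  apply: (measurableT_comp (measurable_poweR _)); exact: osc_measurable.
apply: nonincr_measurable => [|s t /[dup] Is /in_I01/andP[s0 _] /[dup] It /in_I01/andP[_ t1] st].
  exact: is_interval_I01.
rewrite lee_fin lef_pV2 ?posrE; try exact: (A0_pos psiA).
exact: (A0_incr psiA).
Qed.

(** The embedding is applied to [f = h `^ r^-1] with [h] the tail in the conclusion; the
    oscillation of [h] is the mean of [(F * psi) `^ r], which the majorant [S] of
    [hardy_majorant] bounds by [2 * ((S + 1) * psi) `^ r].  A bound on [F] makes the
    tails finite but does not enter the constant [L]. *)
Lemma tail_bounded (R : realType) (r C : R) (rho : (R -> \bar R) -> \bar R)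
    (psi : R -> R) : (0 < r)%R -> (r <= 1)%R -> ri_norm rho -> classA0 psi ->
  (0 < C)%R ->
  (forall f : R -> \bar R, L0 f -> Lp01 +oo f <=
     C%:E * (Xnorm rho (fun t => osc r f t `^ r^-1 * (psi t)^-1%:E)
             + Lp01 r%:E f)) ->
  exists L : R, forall (F : R -> R) (c : R), decr01 F ->
    (forall x, I01 x -> (F x <= c)%R) -> rho (EFin \o F) <= 1 ->
    forall x, I01 x -> tail (fun s => F s `^ r * (psi s `^ r / s))%R x <= L%:E.
Proof.
move=> r0 r1 hX psiA C0 hi; have hb := ri_bfn hX.
have [y y0 hy] := norm_cst1_fin hX.
have [M M0 hM] := hardy_majorant hX psiA.
have [B B0 hB] := psi_bounded psiA.
have [C1 C10 hC1] := bfn_int hb (@measurable_I01 R) (@subset_refl _ _).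
have psi0 t : I01 t -> (0 < psi t)%R by exact: (A0_pos psiA).
have rn0 : r != 0%R by rewrite gt_eqF.
have ri0 : (0 < r^-1)%R by rewrite invr_gt0.
pose K1 : R := (2 `^ r^-1)%R.
have K10 : (0 <= K1)%R by exact: powR_ge0.
pose L1 := (C * (K1 * (M + y) + (B `^ r * (1 + C1)) `^ r^-1))%R.
have L10 : (0 <= L1)%R.
  apply: mulr_ge0; first exact: ltW.
  by rewrite addr_ge0 ?powR_ge0// mulr_ge0// addr_ge0// ltW.
exists (L1 `^ r)%R => F c dF Fc F1; have [F0 Fd] := dF.
have c0 : (0 <= c)%R.
  have I2 : I01 (2^-1 : R)%R by apply/in_I01; lra.
  exact: le_trans (F0 _ I2) (Fc _ I2).
pose p s := (F s `^ r * (psi s `^ r / s))%R.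
have mF : measurable_fun I01 F.
  by apply/measurable_EFinP; exact: (decr01_Mplus dF).1.
have mp : measurable_fun I01 p.
  apply: measurable_funM; last exact: measurable_weight.
  by apply: (measurableT_comp (measurable_powR _)).
pose K := (c `^ r * B `^ r)%R.
have K0 : (0 <= K)%R by rewrite mulr_ge0// powR_ge0.
have le_powR a b : (0 <= a)%R -> (a <= b)%R -> (a `^ r <= b `^ r)%R.
  move=> a0 ab; apply: (ge0_ler_powR (ltW r0)); rewrite ?nnegrE//.
  exact: le_trans ab.
have pK s : I01 s -> (0 <= p s <= K / s)%R.
  move=> Is; have /in_I01/andP[s0 s1] := Is; apply/andP; split.
    by rewrite mulr_ge0 ?powR_ge0// weight_ge0.
  rewrite /p /K mulrA ler_pM2r ?invr_gt0//.
  by rewrite ler_pM ?powR_ge0 ?le_powR ?F0 ?Fc ?hB ?ltW ?psi0.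
have p0 x : I01 x -> (0 <= p x)%R by move=> /pK/andP[].
have psE s : I01 s -> (p s * s = (F s * psi s) `^ r)%R.
  move=> Is; have /in_I01/andP[s0 s1] := Is.
  rewrite /p powRM ?F0// ?ltW ?psi0//.
  by rewrite -!mulrA mulVf ?mulr1// gt_eqF.
pose h := tail p.
have h0 x : 0 <= h x by exact: tail_ge0.
pose f x := h x `^ r^-1.
have f0 x : 0 <= f x by exact: poweR_ge0.
have absf : abspow r f = h.
  apply/funext => x; rewrite /abspow gee0_abs// /f -poweRrM mulVf//.
  by rewrite poweRe1.
have mh : meas01 h by exact: tail_meas01.
have Lf : L0 f.
  split; first by apply: (measurableT_comp (measurable_poweR _)).
  apply: aeW => x Ix; apply: fin_num_poweR.
  by rewrite ge0_fin_numE// (le_lt_trans (tail_le mp pK K0 Ix))// ltry.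
have normr : Lp01 r%:E f <= ((B `^ r * (1 + C1)) `^ r^-1)%:E.
  rewrite Lp01E// absf -poweR_EFin; apply: le_poweR; [exact: ltW|exact: integral_ge0|].
  rewrite /h integral_tail_I01//.
  apply: (@le_trans _ _ (\int[lebesgue_measure]_(s in I01)
     ((B `^ r)%:E * (cst 1 s + (F s)%:E)))).
    apply: ge0_le_integral => //.
    - exact: measurable_I01.
    - move=> s Is; have /in_I01/andP[s0 s1] := Is.
      by rewrite lee_fin mulr_ge0 ?p0// ltW.
    - by apply/measurable_EFinP; apply: measurable_funM.
    - apply: measurable_funeM; apply: emeasurable_funD => //.
      exact/measurable_EFinP.
    - move=> s Is; rewrite -EFinD -EFinM lee_fin psE// powRM ?F0// ?(ltW (psi0 _ _))//.
      rewrite mulrC; apply: ler_pM; rewrite ?powR_ge0//.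
        by apply: le_powR; [exact/ltW/psi0|exact: hB].
      have [Fs1|Fs1] := leP (F s) 1%R.
        by rewrite (le_trans (le_powR _ _ (F0 _ Is) Fs1))// powR1 lerDl F0.
      by rewrite (le_trans (ler1_powR (ltW Fs1) r1))// lerDr.
  have mF' : measurable_fun I01 (EFin \o F) by exact/measurable_EFinP.
  rewrite ge0_integralZl//; last 4 first.
  - exact: measurable_I01.
  - by apply: emeasurable_funD.
  - by move=> s Is; rewrite adde_ge0// lee_fin F0.
  - by rewrite lee_fin powR_ge0.
  rewrite EFinM; apply: lee_wpmul2l; first by rewrite lee_fin powR_ge0.
  rewrite ge0_integralD//; last exact: measurable_I01.
  rewrite EFinD; apply: leeD.
    rewrite integral_one; last exact: measurable_I01.
    by rewrite /I01 lebesgue_measure_itv /= lte_fin ltr01 EFinN oppe0 adde0.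
  apply: (le_trans (hC1 _ (decr01_Mplus dF))).
  by rewrite -[leRHS]mule1; apply: lee_wpmul2l => //; rewrite lee_fin ltW.
have [S [dS TS rS]] := hM F c dF Fc F1.
have oscf t : I01 t ->
    osc r f t <= (2 * ((S t + 1) * psi t) `^ r)%:E.
  move=> It; have /in_I01/andP[t0 t1] := It.
  rewrite /osc absf (osc_tail mp pK K0 It).
  (* S is increased by one because the base has to be positive *)
  have A0 : (0 < (S t + 1) * psi t)%R by rewrite mulr_gt0 ?psi0// ltr_wpDl// dS.1.
  have -> : \int[lebesgue_measure]_(s in `]0%R, t]) (p s * s)%:E =
      \int[lebesgue_measure]_(s in `]0%R, t]) ((F s * psi s) `^ r)%:E.
    apply: eq_integral => s; rewrite inE => /(itv_subI01 (b := false) (lexx 0%R) It) Is.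
    by rewrite psE.
  have J : \int[lebesgue_measure]_(s in `]0%R, t]) ((F s * psi s) `^ r)%:E <=
      (2 * ((S t + 1) * psi t) `^ r * t)%:E.
    apply: mean_powR_le => //.
    - by apply: measurable_funM => //; exact: measurable_psi.
    - by move=> x Ix; rewrite mulr_ge0 ?F0// ltW// psi0.
    - apply: (le_trans (TS t It)); rewrite lee_fin.
      rewrite -mulrA [(t * _)%R]mulrC mulrA ler_pM2r// ler_pM2r ?psi0//.
      by rewrite lerDl.
  rewrite -lee_pdivlMl ?invr_gt0// invrK.
  by apply: (le_trans J); rewrite -EFinM lee_fin mulrC.
have osc0 t : I01 t -> 0 <= osc r f t.
  move=> It; have /in_I01/andP[t0 t1] := It.
  rewrite /osc absf (osc_tail mp pK K0 It) mule_ge0//.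
    by rewrite lee_fin invr_ge0 ltW.
  apply: integral_ge0 => s /(itv_subI01 (b := false) (lexx 0%R) It) Is.
  by have /in_I01/andP[s0 _] := Is; rewrite lee_fin mulr_ge0 ?p0// ltW.
have Xn : Xnorm rho (fun t => osc r f t `^ r^-1 * (psi t)^-1%:E) <=
    (K1 * (M + y))%:E.
  have M1 : Mplus (cst 1 : R -> \bar R) by split => //; exact: measurable_cst.
  have MS1 : Mplus (fun t => (S t)%:E + cst 1 t).
    have [mS pS] := decr01_Mplus dS.
    split; first by apply: emeasurable_funD.
    by move=> x Ix; rewrite adde_ge0 ?pS.
  apply: (@le_trans _ _ (rho (fun t => K1%:E * ((S t)%:E + cst 1 t)))).
    apply: (rho_le hX).
    - split => //; apply: measurableT_comp => //; exact: osc_quotient_measurable.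
    - have [mS pS] := MS1; split; first exact: measurable_funeM.
      by move=> x Ix; rewrite mule_ge0 ?pS.
    - move=> t It; rewrite gee0_abs; last first.
        by rewrite mule_ge0 ?poweR_ge0// lee_fin invr_ge0 ltW// psi0.
      rewrite lee_pdivrMr ?psi0//.
      have St0 : (0 <= S t + 1)%R by rewrite addr_ge0// dS.1.
      apply: (@le_trans _ _ ((2 * ((S t + 1) * psi t) `^ r)%:E `^ r^-1)).
        by apply: le_poweR; [exact: ltW|exact: osc0|exact: oscf].
      rewrite poweR_EFin -EFinD -!EFinM lee_fin powRM ?powR_ge0// -powRrM mulfV//.
      by rewrite powRr1 ?mulr_ge0 ?(ltW (psi0 _ _))// mulrA.
  rewrite (bfn_scale hb)// EFinM; apply: lee_wpmul2l; first by rewrite lee_fin.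
  apply: (le_trans (bfn_triangle hb (decr01_Mplus dS) M1)).
  by rewrite EFinD hy; apply: leeD.
have fL1 : Lp01 +oo f <= L1%:E.
  apply: (le_trans (hi f Lf)); rewrite /L1 EFinM EFinD.
  by apply: lee_wpmul2l; [rewrite lee_fin ltW|exact: leeD].
have /(Lp01yP _ _).1 := fL1; rewrite lee_fin => /(_ L10) aef.
move=> x Ix; rewrite -/p -/(h x).
have fx : f x <= L1%:E.
  rewrite leNgt; apply/negP => Lx.
  have /in_I01/andP[x0 x1] := Ix.
  case: aef => N [mN N0 hN].
  have : lebesgue_measure `]0%R, x[ <= lebesgue_measure N.
    apply: le_measure; rewrite ?inE// => u; rewrite /= in_itv /= => /andP[u0 ux].
    apply: hN => /= hu.
    have Iu : I01 u by apply/in_I01; rewrite u0 (lt_trans ux).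
    have := hu Iu; rewrite gee0_abs// leNgt => /negP; apply.
    apply: (lt_le_trans Lx); apply: le_poweR; [exact: ltW|exact: h0|].
    by apply: tail_mono => //; exact: ltW.
  rewrite N0 lebesgue_measure_itv /= lte_fin x0 EFinN oppe0 adde0 lee_fin.
  by rewrite leNgt x0.
have -> : h x = f x `^ r by rewrite /f -poweRrM mulVf// poweRe1.
by rewrite -poweR_EFin; apply: le_poweR; [exact: ltW|exact: f0|].
Qed.

(** * The rearrangement recovered from the oscillation *)

Lemma integral_inv_sqr (R : realType) (a : R) : (0 < a)%R -> (a < 1)%R ->
  \int[lebesgue_measure]_(x in `]a, 1%R[) (x ^- 2)%:E = (a^-1 - 1)%:E.
Proof.
move=> a0 a1.
have itv0 (x : R) : x \in `[a, 1%R] -> x != 0%R.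
  by rewrite in_itv /= => /andP[ax _]; rewrite gt_eqF// (lt_le_trans a0).
pose F (x : R) : R := (- x^-1)%R.
have dF (x : R) : x != 0%R -> is_derive x 1%R F (x ^- 2)%R.
  move=> x0; rewrite /F.
  have -> : (x ^- 2 = - (- x ^- 2 *: 1))%R by rewrite scaleNr opprK /GRing.scale /= mulr1.
  apply: is_deriveN; apply: DeriveDef.
    exact: (@derivableV _ _ id).
  by rewrite (@deriveV _ _ id)// derive_id.
have cF (x : R) : x != 0%R -> {for x, continuous F}.
  by move=> x0; apply: cvgN; apply: cvgV.
have cinv : {within `[a, 1%R], continuous (fun x : R => x ^- 2)%R}.
  apply: continuous_in_subspaceT => x; rewrite inE /= => /itv0 x0.
  apply: cvgV; first by rewrite expf_neq0.
  exact: exprn_continuous.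
have mF : measurable_fun (`]a, 1%R[%classic : set R) (fun x : R => (x ^- 2)%:E).
  apply: nonincr_measurable => [|s t]; first exact: interval_is_interval.
  rewrite /= !in_itv /= => /andP[sa _] /andP[ta _] st.
  have s0 := lt_trans a0 sa; have t0 := lt_trans a0 ta.
  by rewrite lee_fin lef_pV2 ?posrE ?exprn_gt0// ler_sqr ?nnegrE// ltW.
rewrite -(integral_itv_bndoo true false mF) (continuous_FTC2 a1 cinv (F := F)).
- by rewrite /F invr1 -EFinB opprK addrC.
- have am0 : a != 0%R by rewrite gt_eqF.
  split.
  + move=> x; rewrite in_itv /= => /andP[ax _].
    have x0 : x != 0%R by rewrite gt_eqF// (lt_trans a0).
    by have [] := dF _ x0.
  + exact: cvg_at_right_filter (cF _ am0).
  + exact: cvg_at_left_filter (cF _ (oner_neq0 R)).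
- move=> x; rewrite in_itv /= => /andP[ax _].
  have x0 : x != 0%R by rewrite gt_eqF// (lt_trans a0).
  by rewrite derive1E; have [_ ->] := dF _ x0.
Qed.

(** Both sides are the integral of the distribution function. *)
Lemma rearr_integral (R : realType) (u : R -> \bar R) : meas01 u ->
  \int[lebesgue_measure]_(x in I01) rearr u x =
  \int[lebesgue_measure]_(x in I01) `|u x|.
Proof.
move=> mu; have M1 : Mplus (cst 1 : R -> \bar R) by split => //; exact: measurable_cst.
have E (v : R -> \bar R) : meas01 v -> \int[lebesgue_measure]_(x in I01) `|v x| =
    \int[lebesgue_measure]_(t in `[0%R, +oo[) distr v t.
  move=> mv; under eq_integral do rewrite -[`|_|]mul1e.
  rewrite (layer_cake (w := cst 1))//; apply: eq_integral => t _.
  by rewrite integral_one//; exact: measurable_superlevel.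
rewrite E//.
transitivity (\int[lebesgue_measure]_(x in I01) `|rearr u x|).
  by apply: eq_integral => x _; rewrite gee0_abs// rearr_ge0.
rewrite E; last exact: measurable_rearr.
apply: eq_integral => t; rewrite inE /= in_itv /= andbT => t0.
exact: distr_rearr.
Qed.

Lemma measurable_rearr_sub (R : realType) (u : R -> \bar R) (D : set R) :
  D `<=` I01 -> measurable_fun D (rearr u).
Proof.
move=> DI; apply: (measurable_funS _ DI (measurable_rearr u)).
exact: measurable_I01.
Qed.

Lemma rearr_le_integral (R : realType) (u : R -> \bar R) (t : R) : I01 t ->
  t%:E * rearr u t <= \int[lebesgue_measure]_(s in `]0%R, t[) rearr u s.
Proof.
move=> It; have /in_I01/andP[t0 t1] := It.
have -> : t%:E * rearr u t = \int[lebesgue_measure]_(s in `]0%R, t[) cst (rearr u t) s.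
  rewrite integral_cst//= lebesgue_measure_itv /= lte_fin t0.
  by rewrite EFinN oppe0 adde0 muleC.
apply: ge0_le_integral => //.
- by move=> x _; exact: rearr_ge0.
- apply: measurable_rearr_sub; exact: (itv_subI01 (b := true) (lexx 0%R) It).
- move=> x; rewrite /= in_itv /= => /andP[_ xt]; apply: rearr_mono.
  exact: ltW.
Qed.

Lemma integral_rearr_le (R : realType) (u : R -> \bar R) (D : set R) :
  measurable D -> D `<=` I01 -> meas01 u ->
  \int[lebesgue_measure]_(s in D) rearr u s <=
  \int[lebesgue_measure]_(x in I01) `|u x|.
Proof.
move=> mD DI mu; rewrite -(rearr_integral mu).
apply: ge0_subset_integral => //.
- exact: measurable_I01.
- exact: measurable_rearr.
- by move=> x _; exact: rearr_ge0.
Qed.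

Lemma rearr_fin (R : realType) (u : R -> \bar R) (t : R) : meas01 u ->
  \int[lebesgue_measure]_(x in I01) `|u x| < +oo -> I01 t ->
  rearr u t \is a fin_num.
Proof.
move=> mu ui It; have /in_I01/andP[t0 t1] := It.
have h : t%:E * rearr u t < +oo.
  apply: le_lt_trans ui; apply: (le_trans (rearr_le_integral u It)).
  apply: integral_rearr_le => //.
  exact: (itv_subI01 (b := true) (lexx 0%R) It).
rewrite ge0_fin_numE ?rearr_ge0//; move: h.
by case: (rearr u t) => [x _||]; rewrite ?ltry// gt0_muley ?lte_fin.
Qed.

Lemma osc_ge0 (R : realType) (r : R) (f : R -> \bar R) (t : R) : meas01 f ->
  \int[lebesgue_measure]_(x in I01) abspow r f x < +oo -> I01 t ->
  0 <= osc r f t.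
Proof.
move=> mf gi It; have /in_I01/andP[t0 t1] := It.
have kt : rearr (abspow r f) t \is a fin_num.
  apply: rearr_fin => //; first exact: abspow_measurable.
  congr (_ < +oo) : gi; apply: eq_integral => x _.
  by rewrite gee0_abs// abspow_ge0.
rewrite /osc sube_ge0 ?kt//.
by rewrite /maxrearr lee_pdivlMl// rearr_le_integral.
Qed.

(** The term at [eps] is at most the mean of [k = rearr g] over (0,eps).  This mean is
    the integral of [k] plus the integral [X] of [osc r f t / t] over (eps,1): the
    integral of [k s / t ^+ 2] over [s < t] and [eps < t] can be done in [s] first,
    which gives [X + Y] with [Y] the integral of [k t / t] over (eps,1), or in [t] first,
    which gives the mean plus [Y] minus the integral of [k]. *)
Lemma rearr_le_osc (R : realType) (r : R) (f : R -> \bar R) (eps : R) :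
  meas01 f -> \int[lebesgue_measure]_(x in I01) abspow r f x < +oo ->
  I01 eps ->
  rearr (abspow r f) eps <= \int[lebesgue_measure]_(x in I01) abspow r f x +
    \int[lebesgue_measure]_(t in I01) (t^-1%:E * osc r f t).
Proof.
move=> mf gi Ie; have /in_I01/andP[e0 e1] := Ie.
pose g := abspow r f; pose k := rearr g.
have mg : meas01 g by exact: abspow_measurable.
have gE : \int[lebesgue_measure]_(x in I01) `|g x| =
    \int[lebesgue_measure]_(x in I01) g x.
  by apply: eq_integral => x _; rewrite gee0_abs// abspow_ge0.
have gi' : \int[lebesgue_measure]_(x in I01) `|g x| < +oo by rewrite gE.
have k0 x : 0 <= k x by exact: rearr_ge0.
have kf x : I01 x -> k x \is a fin_num by exact: rearr_fin.
have mk := measurable_rearr g.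
have mkS := @measurable_rearr_sub _ g.
have intk (D : set R) : measurable D -> D `<=` I01 ->
    \int[lebesgue_measure]_(s in D) k s < +oo.
  by move=> mD DI; apply: le_lt_trans gi'; exact: integral_rearr_le.
pose D := `]eps, 1%R[%classic : set R.
have mD : measurable D by exact: measurable_itv.
have DI : D `<=` I01.
  move=> x; rewrite /D /= in_itv /= => /andP[ex x1]; apply/in_I01.
  by rewrite (lt_trans e0 ex).
pose J := `]0%R, eps]%classic : set R.
have mJ : measurable J by exact: measurable_itv.
have JI : J `<=` I01 by exact: (itv_subI01 (b := false) (lexx 0%R) Ie).
have JD : @I01 R = J `|` D.
  apply/seteqP; split => [x /[dup] Ix /in_I01/andP[x0 x1]|x [/JI//|/DI//]].
  rewrite /J /D /= !in_itv /= x0 x1 andbT /=.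
  by case: (leP x eps); [left|right].
have JDd : [disjoint J & D].
  rewrite disj_set2E; apply/eqP/seteqP; split => x //; rewrite /J /D /= !in_itv /=.
  by move=> [/andP[_ sy] /andP[ys _]]; move: (le_lt_trans sy ys); rewrite ltxx.
have minv (E : set R) : is_interval E -> E `<=` I01 ->
    measurable_fun E (fun t : R => t^-1%:E).
  move=> iE EI; apply: nonincr_measurable => // s t /EI/in_I01/andP[s0 _] /EI/in_I01/andP[t0 _] st.
  by rewrite lee_fin lef_pV2 ?posrE.
have iD : is_interval D by exact: interval_is_interval.
have msq : measurable_fun D (fun t : R => (t ^- 2)%:E).
  apply: nonincr_measurable => // s t /DI/in_I01/andP[s0 _] /DI/in_I01/andP[t0 _] st.
  by rewrite lee_fin lef_pV2 ?posrE ?exprn_gt0// ler_sqr ?nnegrE// ltW.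
have osc0 t : I01 t -> 0 <= osc r f t by exact: osc_ge0.
have mosc : measurable_fun I01 (fun t : R => t^-1%:E * osc r f t).
  apply: emeasurable_funM; last exact: osc_measurable.
  by apply: minv => //; exact: is_interval_I01.
pose X := \int[lebesgue_measure]_(t in D) (t^-1%:E * osc r f t).
pose Y := \int[lebesgue_measure]_(t in D) (t^-1%:E * k t).
pose W := \int[lebesgue_measure]_(t in J) (eps^-1%:E * k t).
have Yf : Y \is a fin_num.
  rewrite ge0_fin_numE; last first.
    apply: integral_ge0 => x /DI/in_I01/andP[x0 _].
    by rewrite mule_ge0// lee_fin invr_ge0 ltW.
  apply: (@le_lt_trans _ _ (\int[lebesgue_measure]_(t in D) (eps^-1%:E * k t))).
    apply: ge0_le_integral => //.
    - by move=> x /DI/in_I01/andP[x0 _]; rewrite mule_ge0// lee_fin invr_ge0 ltW.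
    - by apply: emeasurable_funM; [exact: minv|exact: mkS].
    - by apply: measurable_funeM; exact: mkS.
    - move=> x Dx; apply: lee_wpmul2r => //; rewrite lee_fin.
      have /in_I01/andP[x0 _] := DI _ Dx.
      rewrite lef_pV2 ?posrE//; move: Dx; rewrite /D /= in_itv /= => /andP[ex _].
      exact: ltW.
  rewrite ge0_integralZl//; last 2 first.
  - exact: mkS.
  - by rewrite lee_fin invr_ge0 ltW.
  by apply: lte_mul_pinfty; rewrite ?lee_fin ?invr_ge0 ?(ltW e0)//; exact: intk.
have tonelli : \int[lebesgue_measure]_(t in D) (t^-1%:E * maxrearr g t) =
    \int[lebesgue_measure]_(s in I01) (k s * ((Num.max s eps)^-1 - 1)%:E).
  pose A := [set z : measurableTypeR R * measurableTypeR R | z.2%:E < z.1%:E].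
  have mA : measurable A.
    rewrite -[X in measurable X]setTI; apply: measurable_lte => //.
      exact/measurable_EFinP.
    exact/measurable_EFinP.
  have H : \int[lebesgue_measure]_(x in D)
      ((x ^- 2)%:E * \int[lebesgue_measure]_(y in I01 `&` xsection A x) k y) =
    \int[lebesgue_measure]_(y in I01)
      (k y * \int[lebesgue_measure]_(x in D `&` ysection A y) (x ^- 2)%:E).
    apply: (tonelli_region mD (@measurable_I01 R) mA msq mk) => // x _.
    by rewrite lee_fin invr_ge0 sqr_ge0.
  transitivity (\int[lebesgue_measure]_(x in D)
      ((x ^- 2)%:E * \int[lebesgue_measure]_(y in I01 `&` xsection A x) k y)).
    apply: eq_integral => t; rewrite inE => Dt.
    have It := DI _ Dt; have /in_I01/andP[t0 t1] := It.
    rewrite /maxrearr muleA -EFinM -invfM -expr2; congr (_ * _).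
    congr integral; apply/seteqP; split => s; rewrite /xsection /A /=.
      rewrite in_itv /= => /andP[s0 st]; split; last by rewrite inE /= lte_fin.
      by apply/in_I01; rewrite s0 (lt_trans st).
    move=> [/in_I01/andP[s0 s1]]; rewrite inE /= lte_fin in_itv /= => ->.
    by rewrite s0.
  rewrite H; apply: eq_integral => s; rewrite inE => /in_I01/andP[s0 s1].
  congr (_ * _).
  have -> : D `&` ysection A s = `]Num.max s eps, 1%R[%classic.
    apply/seteqP; split => t; rewrite /D /ysection /A /= !in_itv /= inE /= lte_fin gt_max.
      by move=> [/andP[-> ->] ->].
    by move=> /andP[/andP[-> ->] ->].
  rewrite integral_inv_sqr//; first by rewrite lt_max s0.
  by rewrite gt_max s1.
have lhs : \int[lebesgue_measure]_(t in D) (t^-1%:E * maxrearr g t) = X + Y.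
  rewrite /X /Y -ge0_integralD//; last 4 first.
  - move=> x /DI Ix; have /in_I01/andP[x0 _] := Ix.
    by rewrite mule_ge0 ?osc0// lee_fin invr_ge0 ltW.
  - apply: (measurable_funS _ DI mosc); exact: measurable_I01.
  - by move=> x /DI/in_I01/andP[x0 _]; rewrite mule_ge0// lee_fin invr_ge0 ltW.
  - by apply: emeasurable_funM; [exact: minv|exact: mkS].
  apply: eq_integral => t; rewrite inE => /DI It.
  rewrite -ge0_muleDr ?osc0//; congr (_ * _).
  by rewrite /osc -/g -/(k t) subeK// kf.
have ms1 : (forall s : R, I01 s -> (0 <= (Num.max s eps)^-1 - 1)%R).
  move=> s /in_I01/andP[s0 s1].
  by rewrite subr_ge0 invf_ge1 ?ge_max ?(ltW s1) ?(ltW e1)// lt_max s0.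
have mmax : measurable_fun I01 (fun s : R => ((Num.max s eps)^-1 - 1)%:E).
  apply: nonincr_measurable => [|s t /in_I01/andP[s0 _] /in_I01/andP[t0 _] st].
    exact: is_interval_I01.
  rewrite lee_fin lerD2r lef_pV2 ?posrE ?lt_max ?s0 ?t0//.
  by rewrite ge_max !le_max st lexx orbT.
have rhs : \int[lebesgue_measure]_(s in I01) (k s * ((Num.max s eps)^-1 - 1)%:E)
    + \int[lebesgue_measure]_(s in I01) k s = W + Y.
  rewrite -ge0_integralD//; last 3 first.
  - exact: measurable_I01.
  - by move=> s /ms1 h; rewrite mule_ge0.
  - by apply: emeasurable_funM.
  transitivity (\int[lebesgue_measure]_(s in I01) ((Num.max s eps)^-1%:E * k s)).
    apply: eq_integral => s; rewrite inE => Is; rewrite -{2}[k s]mule1 -ge0_muleDr ?lee_fin ?ms1//.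
    by rewrite -EFinD subrK muleC.
  rewrite JD ge0_integral_setU//; last 2 first.
  - rewrite -JD; apply: emeasurable_funM => //.
    apply: nonincr_measurable => [|s t /in_I01/andP[s0 _] /in_I01/andP[t0 _] st].
      exact: is_interval_I01.
    rewrite lee_fin lef_pV2 ?posrE ?lt_max ?s0 ?t0//.
    by rewrite ge_max !le_max st lexx orbT.
  - rewrite -JD => s /in_I01/andP[s0 _]; rewrite mule_ge0// lee_fin invr_ge0.
    by rewrite le_max ltW.
  congr (_ + _); apply: eq_integral => s; rewrite inE /J /D /= in_itv /= => /andP[h1 h2].
    by rewrite max_r.
  by rewrite max_l// ltW.
have We : k eps <= W.
  rewrite /W ge0_integralZl//; last 2 first.
  - exact: mkS.
  - by rewrite lee_fin invr_ge0 ltW.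
  rewrite lee_pdivlMl//; apply: (le_trans (rearr_le_integral g Ie)).
  apply: ge0_subset_integral => //; first exact: mkS.
  by apply: subset_itvl; rewrite bnd_simp.
have XW : X + \int[lebesgue_measure]_(s in I01) k s = W.
  have : X + \int[lebesgue_measure]_(s in I01) k s + Y = W + Y.
    by rewrite -rhs -tonelli lhs addeAC.
  move=> /(congr1 (fun z => z - Y)).
  by rewrite !addeK.
apply: (le_trans We); rewrite -XW addeC rearr_integral// gE.
apply: leeD => //; apply: ge0_subset_integral => //; first exact: measurable_I01.
by move=> t It; have /in_I01/andP[t0 _] := It; rewrite mule_ge0 ?osc0// lee_fin invr_ge0 ltW.
Qed.

(** * The two implications *)

(** For [g] in the unit ball, the rearrangement [Fs] of [|g| `^ r^-1] is in the unit ball of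
    X.  The integral of [w * rearr g] is the limit of the integrals over (x,1), where
    [Fs] agrees with its truncation at the level [Fs x], so that each of them is a tail
    to which [tail_bounded] applies. *)
Lemma associate_lty_of_ess_sup_bound (R : realType) (r C : R) (rho : (R -> \bar R) -> \bar R)
    (psi : R -> R) : (0 < r)%R -> (r <= 1)%R -> ri_norm rho -> classA0 psi ->
  (0 < C)%R ->
  (forall f : R -> \bar R, L0 f -> Lp01 +oo f <=
     C%:E * (Xnorm rho (fun t => osc r f t `^ r^-1 * (psi t)^-1%:E)
             + Lp01 r%:E f)) ->
  associate (convexification (Xnorm rho) r^-1)
    (fun s => (psi s `^ r / s * \1_I01 s)%:E) < +oo.
Proof.
move=> r0 r1 hX psiA C0 hi; have hb := ri_bfn hX.
have ri0 : (0 < r^-1)%R by rewrite invr_gt0.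
have [L hL] := tail_bounded r0 r1 hX psiA C0 hi.
have [Cw Cw1 hw] := weight_almost_decr psiA r0 r1.
have [C1 C10 hC1] := bfn_int hb (@measurable_I01 R) (@subset_refl _ _).
pose w (s : R) : R := (psi s `^ r / s)%R.
have mw : measurable_fun I01 w by exact: measurable_weight.
have w0 s : I01 s -> (0 <= w s)%R by exact: weight_ge0.
apply: (@le_lt_trans _ _ (Cw ^+ 2 * L)%:E); last exact: ltry.
apply: ge_ereal_sup => _ [g [mg Ng] <-].
pose F0 := abspow r^-1 g.
have MF0 : Mplus F0.
  by split => [|x _]; [exact: abspow_measurable|exact: abspow_ge0].
have rF0 : rho F0 <= 1.
  move: Ng; rewrite /convexification invrK -/F0 (Xnorm_Mplus hX MF0) => N1.
  rewrite leNgt; apply/negP => h.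
  have := lt_poweR_root r0 (@ler01 R) (bfn_ge0 hb MF0).
  by rewrite powR1 h ltNge N1.
have intF0' : \int[lebesgue_measure]_(x in I01) `|F0 x| < +oo.
  apply: (@le_lt_trans _ _ C1%:E); last exact: ltry.
  have -> : \int[lebesgue_measure]_(x in I01) `|F0 x| =
      \int[lebesgue_measure]_(x in I01) F0 x.
    by apply: eq_integral => x _; rewrite gee0_abs// abspow_ge0.
  apply: (le_trans (hC1 _ MF0)); rewrite -[leRHS]mule1.
  by apply: lee_wpmul2l => //; rewrite lee_fin ltW.
have L0F0 : L0 F0.
  split; first exact: MF0.1.
  apply: integrable_ae; first exact: measurable_I01.
  by apply/integrableP; split => //; exact: MF0.1.
pose Fs := rearr F0.
have Fs0 t : 0 <= Fs t by exact: rearr_ge0.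
have Fsf t : I01 t -> Fs t \is a fin_num by apply: rearr_fin => //; exact: MF0.1.
have L0Fs : L0 Fs by split; [exact: measurable_rearr|exact: aeW].
have rFs : rho Fs <= 1.
  rewrite -(Xnorm_Mplus hX (rearr_Mplus F0)) (ri_rearr hX L0Fs L0F0).
    by rewrite (Xnorm_Mplus hX MF0).
  by move=> s _; rewrite /Fs rearr_idem//; exact: MF0.1.
have gE s : rearr g s = Fs s `^ r.
  rewrite /Fs /F0 rearr_abspow// /abspow gee0_abs ?rearr_ge0//.
  by rewrite -poweRrM mulVf ?gt_eqF// poweRe1// rearr_ge0.
have trunc x : I01 x ->
  \int[lebesgue_measure]_(s in I01 `&` [set s | (x < s)%R]) ((w s)%:E * rearr g s)
    <= L%:E.
  move=> Ix; pose F s := fine (mine (Fs s) (Fs x)).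
  have Ff s : mine (Fs s) (Fs x) \is a fin_num.
    rewrite ge0_fin_numE; last by rewrite le_min !Fs0.
    apply: (@le_lt_trans _ _ (Fs x)); first by rewrite ge_min lexx orbT.
    by rewrite -ge0_fin_numE ?Fsf.
  have dF : decr01 F.
    split => [s _|s t s0 st t1]; first by rewrite fine_ge0// le_min !Fs0.
    rewrite fine_le// le_min ge_min ge_min lexx orbT andbT.
    by rewrite rearr_mono.
  have Fc s : I01 s -> (F s <= fine (Fs x))%R.
    by move=> _; rewrite fine_le ?Fsf// ge_min lexx orbT.
  have rF : rho (EFin \o F) <= 1.
    apply: le_trans rFs; apply: (rho_le hX); [exact: decr01_Mplus|exact: rearr_Mplus|].
    by move=> s Is; rewrite /= fineK// ge_min lexx.
  apply: le_trans (hL F _ dF Fc rF x Ix).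
  rewrite le_eqVlt; apply/orP; left; apply/eqP; rewrite /tail.
  apply: eq_integral => s; rewrite inE => -[Is /= xs].
  rewrite [in RHS]mulrC [in RHS]EFinM -/(w s); congr (_ * _); rewrite gE -poweR_EFin fineK//.
  by rewrite min_l// rearr_mono// ltW.
(* n.+2 keeps the left endpoint inside (0,1) *)
pose An (n : nat) : set R := I01 `&` [set s | (n.+2%:R^-1 < s)%R].
have mwg : measurable_fun I01 (fun s => (w s)%:E * rearr g s).
  by apply: emeasurable_funM; [exact/measurable_EFinP|exact: measurable_rearr].
have cvA : \int[lebesgue_measure]_(s in An n) ((w s)%:E * rearr g s) @[n --> \oo] -->
    \int[lebesgue_measure]_(s in \bigcup_n An n) ((w s)%:E * rearr g s).
  apply: ge0_nondecreasing_set_cvg_integral.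
  - move=> m n mn; rewrite subsetEset => s [Is /= h]; split => //=.
    by apply: le_lt_trans h; rewrite lef_pV2 ?posrE// ler_nat.
  - by move=> n; exact: measurable_I01_gt.
  - move=> n; apply: (measurable_funS _ _ mwg); first exact: measurable_I01.
    by move=> s [].
  - by move=> n s [Is _]; rewrite mule_ge0 ?rearr_ge0// lee_fin w0.
have AU : \bigcup_n An n = I01.
  apply/seteqP; split => [s [n _ []]//|s Is].
  have /in_I01/andP[s0 s1] := Is.
  exists (Num.bound s^-1) => //; split => //=.
  rewrite invf_plt ?posrE//.
  apply: (@lt_le_trans _ _ (Num.bound s^-1)%:R%R).
    by apply: archi_boundP; rewrite invr_ge0 ltW.
  by rewrite ler_nat; exact: leqW.
have intL : \int[lebesgue_measure]_(s in I01) ((w s)%:E * rearr g s) <= L%:E.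
  rewrite -AU -(cvg_lim _ cvA)//; apply: lime_le; first by apply: cvgP cvA.
  apply: nearW => n; apply: trunc; apply/in_I01.
  by rewrite invr_gt0 ltr0n/= invf_lt1 ?ltr1n.
have -> : \int[lebesgue_measure]_(s in I01) `|g s * (psi s `^ r / s * \1_I01 s)%:E| =
    \int[lebesgue_measure]_(s in I01) ((w s)%:E * `|g s|).
  apply: eq_integral => s; rewrite inE => Is.
  rewrite indicE mem_set// mulr1 abseM muleC -/(w s); congr (_ * _).
  by rewrite gee0_abs// lee_fin w0.
apply: (le_trans (hardy_littlewood Cw1 mw w0 hw mg)).
by rewrite [leRHS]EFinM; apply: lee_wpmul2l => //; rewrite lee_fin sqr_ge0.
Qed.

(** The distribution function at [T] is at most every [e]. *)
Lemma ae_le_of_rearr_le (R : realType) (f : R -> \bar R) (T : R) : meas01 f ->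
  (0 <= T)%R -> (forall e, I01 e -> rearr f e <= T%:E) ->
  \forall x \ae lebesgue_measure, I01 x -> `|f x| <= T%:E.
Proof.
move=> mf T0 hT.
have d0 : distr f T = 0.
  apply/eqP; rewrite eq_le distr_ge0 andbT; apply/lee_addgt0Pr => e e0.
  rewrite add0e; pose e' := Num.min e 2^-1%R.
  have Ie' : I01 e' by apply/in_I01; rewrite lt_min e0 /= gt_min; apply/andP; split; lra.
  apply: (@le_trans _ _ e'%:E); last by rewrite lee_fin ge_min lexx.
  by rewrite leNgt -lt_rearr// -leNgt hT.
exists [set x | I01 x /\ T%:E < `|f x|]; split => //.
  exact: measurable_superlevel.
move=> x /= nx; have [Ix h] := (not_implyP _ _).1 nx; split => //.
by rewrite ltNge; apply/negP.
Qed.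

(** [M] bounds both terms of the sum and is positive, so that [osc / (M * psi) `^ r] can
    be used in the definition of the associate norm whether or not the norm of
    [osc `^ r^-1 / psi] vanishes. *)
Lemma ess_sup_le_of_associate (R : realType) (r A M : R) (rho : (R -> \bar R) -> \bar R)
    (psi : R -> R) (f : R -> \bar R) :
  (0 < r)%R -> ri_norm rho -> classA0 psi ->
  (0 <= A)%R ->
  associate (convexification (Xnorm rho) r^-1)
    (fun s => (psi s `^ r / s * \1_I01 s)%:E) <= A%:E ->
  L0 f -> (0 < M)%R ->
  Xnorm rho (fun t => osc r f t `^ r^-1 * (psi t)^-1%:E) <= M%:E ->
  Lp01 r%:E f <= M%:E ->
  Lp01 +oo f <= ((1 + A) `^ r^-1 * M)%:E.
Proof.
move=> r0 hX psiA A0 hA [mf _] M0 XM LM; have hb := ri_bfn hX.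
have ri0 : (0 < r^-1)%R by rewrite invr_gt0.
have rn0 : r != 0%R by rewrite gt_eqF.
have psi0 t : I01 t -> (0 < psi t)%R by exact: (A0_pos psiA).
have mg := abspow_measurable r mf.
have Mr0 : (0 <= M `^ r)%R by exact: powR_ge0.
have gM : \int[lebesgue_measure]_(x in I01) abspow r f x <= (M `^ r)%:E.
  have i0 : 0 <= \int[lebesgue_measure]_(x in I01) abspow r f x.
    by apply: integral_ge0 => x _; exact: abspow_ge0.
  rewrite -[leLHS](poweRe1 i0) -(mulVf rn0) poweRrM -Lp01E// -poweR_EFin.
  apply: le_poweR => //; first exact: ltW.
  by rewrite Lp01E// poweR_ge0.
have gi : \int[lebesgue_measure]_(x in I01) abspow r f x < +oo.
  by apply: le_lt_trans gM _; exact: ltry.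
have osc0 t : I01 t -> 0 <= osc r f t by exact: osc_ge0.
pose phi t := osc r f t * (((M * psi t)^-1) `^ r)%:E.
have Mpsi0 t : I01 t -> (0 < M * psi t)%R by move=> It; rewrite mulr_gt0// psi0.
have mphi : meas01 phi.
  apply: emeasurable_funM; first exact: osc_measurable.
  apply: nonincr_measurable => [|s t Is It st]; first exact: is_interval_I01.
  have /in_I01/andP[s0 _] := Is; have /in_I01/andP[_ t1] := It.
  rewrite lee_fin; apply: (ge0_ler_powR (ltW r0)); rewrite ?nnegrE ?invr_ge0 ?(ltW (Mpsi0 _ _))//.
  by rewrite lef_pV2 ?posrE ?Mpsi0// ler_pM2l//; exact: (A0_incr psiA).
pose q t := osc r f t `^ r^-1 * (psi t)^-1%:E.
have Mq : Mplus (fun t => `|q t|).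
  by split => //; apply: measurableT_comp => //; exact: osc_quotient_measurable.
have phiq t : I01 t -> abspow r^-1 phi t = M^-1%:E * `|q t|.
  move=> It; rewrite /abspow /phi gee0_abs; last first.
    by rewrite mule_ge0 ?osc0// lee_fin powR_ge0.
  rewrite poweRM ?osc0 ?lee_fin ?powR_ge0// poweR_EFin -powRrM mulfV//.
  rewrite powRr1 ?invr_ge0 ?(ltW (Mpsi0 _ _))//.
  rewrite gee0_abs; last by rewrite mule_ge0 ?poweR_ge0// lee_fin invr_ge0 ltW// psi0.
  by rewrite invfM EFinM muleCA.
have Nphi : convexification (Xnorm rho) r^-1 phi <= 1.
  have Maphi : Mplus (abspow r^-1 phi).
    by split => [|x _]; [exact: abspow_measurable|exact: abspow_ge0].
  rewrite /convexification invrK -(poweR1r r) Xnorm_Mplus//.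
  apply: le_poweR; [exact: ltW|exact: (bfn_ge0 hb)|].
  apply: (@le_trans _ _ (rho (fun t => M^-1%:E * `|q t|))).
    apply: (rho_le hX) => //; last by move=> t It; rewrite phiq.
    split; first by apply: measurable_funeM; exact: Mq.1.
    by move=> t _; rewrite mule_ge0// lee_fin invr_ge0 ltW.
  rewrite (bfn_scale hb) ?invr_ge0 ?(ltW M0)//.
  by rewrite lee_pdivrMl// mule1.
pose w (s : R) : R := (psi s `^ r / s)%R.
have oscA : \int[lebesgue_measure]_(t in I01) (t^-1%:E * osc r f t) <= (M `^ r * A)%:E.
  have -> : \int[lebesgue_measure]_(t in I01) (t^-1%:E * osc r f t) =
      \int[lebesgue_measure]_(t in I01)
        ((M `^ r)%:E * `|phi t * (psi t `^ r / t * \1_I01 t)%:E|).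
    apply: eq_integral => t; rewrite inE => It; have /in_I01/andP[t0 t1] := It.
    rewrite indicE mem_set// mulr1 gee0_abs; last first.
      by rewrite !mule_ge0 ?osc0// lee_fin ?weight_ge0 ?powR_ge0.
    rewrite /phi -muleA -EFinM muleCA -EFinM muleC; congr (_ * _%:E).
    have z0 : (0 <= (M * psi t)^-1)%R by rewrite invr_ge0 ltW// Mpsi0.
    have p0 : (0 <= psi t)%R by rewrite ltW// psi0.
    have -> : (M `^ r * ((M * psi t)^-1 `^ r * (psi t `^ r / t)) =
      (M * ((M * psi t)^-1 * psi t)) `^ r / t)%R.
      by rewrite (powRM _ (ltW M0) (mulr_ge0 z0 p0)) (powRM _ z0 p0) !mulrA.
    by rewrite mulrCA mulVf ?powR1 ?mul1r// gt_eqF// Mpsi0.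
  rewrite ge0_integralZl//; last 2 first.
  - exact: measurable_I01.
  - apply: measurableT_comp => //; apply: emeasurable_funM => //.
    apply/measurable_EFinP; apply: measurable_funM; first exact: measurable_weight.
    by apply: measurable_indic; exact: measurable_I01.
  rewrite EFinM; apply: lee_wpmul2l; first by rewrite lee_fin.
  by apply: le_trans hA; apply: ereal_sup_ubound; exists phi.
have kM e : I01 e -> rearr (abspow r f) e <= (M `^ r * (1 + A))%:E.
  move=> Ie; apply: (le_trans (rearr_le_osc mf gi Ie)).
  by rewrite mulrDr mulr1 EFinD; apply: leeD.
have lam0 : (0 <= M `^ r * (1 + A))%R by rewrite mulr_ge0// addr_ge0.
have T0 : (0 <= (1 + A) `^ r^-1 * M)%R by rewrite mulr_ge0 ?powR_ge0// ltW.
apply/Lp01yP; first by rewrite lee_fin.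
have [N [mN N0 hN]] := ae_le_of_rearr_le mg lam0 kM.
exists N; split => // x /= nx; apply: hN => /= h; apply: nx => Ix.
move: (h Ix); rewrite gee0_abs ?abspow_ge0// /abspow.
rewrite leNgt lt_poweR_root// -leNgt => /le_trans; apply.
rewrite lee_fin powRM ?addr_ge0// -powRrM mulfV// powRr1 ?(ltW M0)//.
by rewrite mulrC.
Qed.

Theorem theorem7 (R : realType) (r : R) (rho : (R -> \bar R) -> \bar R)
    (psi : R -> R) (hr0 : (0 < r)%R) (hr1 : (r <= 1)%R)
    (hX : ri_norm rho) (hpsi : classA0 psi) :
  (exists2 C : R, (0 < C)%R &
     forall f : R -> \bar R, L0 f ->
       Lp01 +oo f <=
         C%:E * (Xnorm rho (fun t => osc r f t `^ r^-1 * (psi t)^-1%:E)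
                 + Lp01 r%:E f))
  <->
  associate (convexification (Xnorm rho) r^-1)
    (fun s => (psi s `^ r / s * \1_I01 s)%:E) < +oo.
Proof.
split=> [[C C0 hC]|fin]; first exact: associate_lty_of_ess_sup_bound hC.
set N := associate _ _ in fin *.
have [A A0 hA] : exists2 A : R, (0 <= A)%R & N <= A%:E.
  case: N fin => [a| |] // _; last by exists 0%R; rewrite ?leNye.
  by exists (Num.max a 0%R); rewrite ?lee_fin le_max lexx ?orbT.
pose C := ((1 + A) `^ r^-1)%R.
have C0 : (0 < C)%R by rewrite powR_gt0// ltr_pwDl.
exists C => // f Lf.
set X := Xnorm _ _; set L := Lp01 r%:E f.
have X0 : 0 <= X.
  apply: (bfn_ge0 (ri_bfn hX)); split => //; apply: measurableT_comp => //.
  exact: osc_quotient_measurable.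
have L0' : 0 <= L by rewrite /L Lp01E// poweR_ge0.
case ES : (X + L) => [s| |]; last first.
- by move: (adde_ge0 X0 L0'); rewrite ES.
- by rewrite gt0_muley ?lte_fin// leey.
have s0 : (0 <= s)%R by rewrite -lee_fin -ES adde_ge0.
(* The sum may be zero, whereas [ess_sup_le_of_associate] divides by its bound. *)
rewrite -EFinM; apply/lee_addgt0Pr => e e0.
have eC : (0 < e / C)%R by rewrite divr_gt0.
have -> : ((C * s)%:E + e%:E = (C * (s + e / C))%:E).
  by rewrite -EFinD mulrDr mulrCA divff ?gt_eqF// mulr1.
apply: (ess_sup_le_of_associate hr0 hX hpsi A0 hA Lf).
- by rewrite ltr_wpDl.
- apply: (@le_trans _ _ s%:E); last by rewrite lee_fin lerDl ltW.
  by rewrite -ES leeDl.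
- apply: (@le_trans _ _ s%:E); last by rewrite lee_fin lerDl ltW.
  by rewrite -ES leeDr.
Qed.
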